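(* Let $k\ge3$ and let $1\le n_1\le\cdots\le n_k$ be integers. Then $\sigma_6(\mathbf{P}^{n_1}\times\cdots\times\mathbf{P}^{n_k})$ is non-defective, with exactly the following exceptions (in which it is defective): (a) $k=3$ and $(n_1,n_2,n_3)=(1,3,a)$ with $a\ge6$; (b) $k=3$ and $(n_1,n_2,n_3)=(1,4,a)$ with $a\ge6$; (c) $k=3$ and $(n_1,n_2,n_3)=(2,2,a)$ with $a\ge6$; (d) $k=4$ and $(n_1,n_2,n_3,n_4)=(1,1,1,a)$ with $a\ge6$.
   Context: Work over a field of characteristic zero (not necessarily algebraically closed). $\mathbf{P}^{n_1}\times\cdots\times\mathbf{P}^{n_k}$ denotes the Segre variety embedded in $\mathbf{P}(V_1\otimes\cdots\otimes V_k)$, where $\dim V_i=n_i+1$. For a variety $X\subseteq\mathbf{P}^m$, the $s$-secant variety $\sigma_s(X)$ is the Zariski closure of the union of the linear spans of $s$-tuples of points of $X$. For the Segre variety $X$, $\sigma_s(X)$ is called non-defective if it has the expected dimension $\min\{\prod_{i=1}^k(n_i+1)-1,\ s\sum_{i=1}^kn_i+s-1\}$, and defective if its dimension is smaller. *)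

(* Defs.v *)
From mathcomp Require Export all_boot all_order all_algebra.
From mathcomp Require Export mpoly.
From mathcomp Require Export ring_quotient.

Set Implicit Arguments.
Unset Strict Implicit.
Unset Printing Implicit Defensive.

Import GRing.Theory.
Local Open Scope ring_scope.

(* A point of the projective space P(K^N) is represented by any of its nonzero
   coordinate vectors, and a subset of P(K^N) by the predicate on 'rV[K]_N
   satisfied by all nonzero representatives of its points. *)
Section Projective.
Variables (K : fieldType) (N : nat).
Implicit Types (X Z : 'rV[K]_N -> Prop) (f : {mpoly K[N]}).

Definition vanishes_on Z f : Prop := forall v, Z v -> f.@[v 0] = 0.

Definition zariski_closure Z : 'rV[K]_N -> Prop := fun v =>
  v != 0 /\
  forall (e : nat) f, f \is e.-homog -> vanishes_on Z f -> f.@[v 0] = 0.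

Definition secant_union (s : nat) X : 'rV[K]_N -> Prop := fun v =>
  v != 0 /\
  exists p : s.-tuple 'rV[K]_N, (forall x, x \in p -> X x) /\ v \in <<p>>%VS.

Definition secant (s : nat) X := zariski_closure (secant_union s X).

Definition homogeneous_ideal (P : {pred {mpoly K[N]}}) : Prop :=
  idealr_closed P /\
  (forall f, f \in P -> forall e : nat, pihomog mdeg e f \in P).

(* The points of Proj K[x_0, ..., x_(N-1)]: idealr_closed makes P proper, and
   the last clause says that P does not contain the irrelevant ideal. *)
Definition proj_prime (P : {pred {mpoly K[N]}}) : Prop :=
  [/\ homogeneous_ideal P, prime_idealr_closed P & exists i, 'X_i \notin P].

Definition contains_ideal_of Z (P : {pred {mpoly K[N]}}) : Prop :=
  forall (e : nat) f, f \is e.-homog -> vanishes_on Z f -> f \in P.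

(* A chain P_0 < ... < P_d of homogeneous primes of the homogeneous coordinate
   ring of Z; equivalently a chain of d + 1 distinct irreducible closed subsets
   of the projective K-scheme defined by the homogeneous ideal of Z. *)
Definition prime_chain Z (d : nat) : Prop :=
  exists P : 'I_d.+1 -> {pred {mpoly K[N]}},
    (forall i, proj_prime (P i) /\ contains_ideal_of Z (P i)) /\
    (forall i j : 'I_d.+1, (i < j)%N ->
       {subset P i <= P j} /\ ~ {subset P j <= P i}).

(* Krull dimension, taken scheme-theoretically rather than on the space of
   K-rational points: K need not be algebraically closed, and the latter space
   can have too few irreducible closed subsets. *)
Definition has_dim Z (d : nat) : Prop :=
  prime_chain Z d /\ (forall d', prime_chain Z d' -> (d' <= d)%N).

End Projective.

Section Segre.
Variables (K : fieldType) (k : nat) (n : k.-tuple nat).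

(* The coordinates of V_1 (x) ... (x) V_k, with V_i = K^(n_i + 1), are indexed
   by the multi-indices (j_1, ..., j_k) with 0 <= j_i <= n_i. *)
Definition multi_index : finType := {dffun forall i : 'I_k, 'I_(tnth n i).+1}.

Definition tensor_space := 'rV[K]_#|{: multi_index}|.

Definition pure_tensor (a : forall i : 'I_k, 'rV[K]_(tnth n i).+1) :
    tensor_space :=
  \row_t \prod_(i < k) a i 0 ((enum_val t : multi_index) i).

Definition segre : tensor_space -> Prop := fun v =>
  v != 0 /\ exists a, v = pure_tensor a.

Definition segre_secant_expdim (s : nat) : nat :=
  minn (\prod_(i < k) (tnth n i).+1 - 1)%N
       (s * (\sum_(i < k) tnth n i) + s - 1)%N.

Definition segre_secant_nondefective (s : nat) : Prop :=
  has_dim (secant s segre) (segre_secant_expdim s).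

Definition segre_secant_defective (s : nat) : Prop :=
  exists2 d, has_dim (secant s segre) d & (d < segre_secant_expdim s)%N.

End Segre.

(* Main.v *)
Require Import Defs.
From Stdlib Require Import Classical.
From mathcomp Require Import ring zify.

(** Why the theorem is true.

    A sum of six pure tensors is the value, at the vector of all entries of all
    factors, of a polynomial map Phi (segre_map) whose components are
    homogeneous of degree k.  Over an infinite field a homogeneous polynomial
    vanishes on the secant variety exactly when it lies in the kernel of the
    substitution f |-> f(Phi), so the dimension asked for is the Krull
    dimension of the projective scheme defined by this kernel.  It is bounded
    from both sides without any general dimension theory.

    Above: in a chain of primes P_0 < ... < P_D, elements f_i of P_(i+1)
    outside P_i are algebraically independent modulo P_0
    (alg_indep_mod_chain), while r + 1 polynomials in r variables are
    dependent, by counting monomials.  If the secant variety is dominated by a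
    map psi in r variables, then its dimension is at most r - 1
    (prime_chain_lt_vars, secant_dim_lt).  Dividing out the scalings of the
    factors gives r = 6 (1 + sum n_i).  For an unbalanced format (the
    exceptions) sums of six pure tensors are matrices of rank at most six, and
    the parametrization of such matrices by echelon forms gives fewer
    variables than expected.

    Below (prime_chain_of_jacobian): if the Jacobian matrix of Phi has rank r at
    a, choose a linear space of dimension r through a on which the differential
    is injective, and a full flag L_1 < ... < L_r in it with a in L_1.  The
    kernels of f |-> f(Phi restricted to L_j) are homogeneous primes, and they
    are pairwise distinct: in characteristic zero Phi restricted to L_j has j
    algebraically independent components, Phi restricted to L_(j-1) has at most
    j - 1.  This is the part of Terracini's lemma that is needed.

    It remains to find six points whose affine tangent spaces are linearly
    independent, or span the tensor space.  Independence survives when some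
    n_i grow or factors are added (tangents_independent_raise,
    tangents_independent_pad), spanning survives when some n_i shrink.  So
    everything follows from finitely many small formats, plus the formats
    (1, 2, c), in which six pure tensors of the first two factors form a basis.
    For the small formats explicit integer points work: Gaussian elimination
    modulo 7 shows that the matrix of tangent vectors has full rank, and
    a minor that is nonzero modulo 7 is nonzero in characteristic zero. *)

Set Implicit Arguments.
Unset Strict Implicit.
Unset Printing Implicit Defensive.

Import GRing.Theory.
Local Open Scope ring_scope.

(** * Derivations of polynomials, and polynomials over infinite fields *)

Lemma mderiv_var (R : nzRingType) n (i j : 'I_n) :
  ('X_i : {mpoly R[n]})^`M(j) = ((i == j)%:R)%:MP.
Proof.
apply/mpolyP => m; rewrite mderivX mnm1E mcoeffZ mcoeffX mcoeffC.
case: eqP => [->|_]; last by rewrite !mul0r.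
suff -> : (U_(j) - U_(j) = 0 :> 'X_{1..n})%MM by rewrite eq_sym.
by apply/mnmP => l; rewrite mnmBE subnn mnmE.
Qed.

Section ChainRule.
Variables (K : fieldType) (n : nat) (S : comNzRingType).
Variables (f : {rmorphism K -> S}) (h : 'I_n -> S) (D : {additive S -> S}).
Hypothesis DM : forall x y, D (x * y) = D x * y + x * D y.
Hypothesis Df : forall c, D (f c) = 0.

Let chain p := D (mmap f h p) = \sum_i mmap f h p^`M(i) * D (h i).

Let chainM p q : chain p -> chain q -> chain (p * q).
Proof.
rewrite /chain => Hp Hq.
rewrite rmorphM DM Hp Hq /= big_distrl big_distrr -big_split /=.
apply: eq_bigr => i _; rewrite mderivM rmorphD !rmorphM /=; ring.
Qed.

Let chainC c : chain c%:MP.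
Proof.
rewrite /chain mmapC Df big1 // => i _.
by rewrite mderivC rmorph0 mul0r.
Qed.

Let chainX i : chain 'X_i.
Proof.
rewrite /chain mmapX mmap1U (bigD1 i) //= big1 ?addr0 => [|j ji].
  by rewrite mderiv_var eqxx rmorph1 mul1r.
by rewrite mderiv_var eq_sym (negbTE ji) mpolyC0 rmorph0 mul0r.
Qed.

(** The polynomials that obey the chain rule are closed under sums and
    products and contain constants and variables.  Stated for any derivation
    that kills scalars, so that it serves both the partial derivatives of a
    composition and the derivative along a line. *)
Lemma derivation_mmap p :
  D (mmap f h p) = \sum_i mmap f h p^`M(i) * D (h i).
Proof.
rewrite -/(chain p) [p]mpolyE.
elim/big_ind: _ => [|q r Hq Hr|m _].
- by rewrite -mpolyC0; apply: chainC.
- rewrite /chain rmorphD raddfD Hq Hr -big_split /=.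
  by apply: eq_bigr => i _; rewrite mderivD rmorphD mulrDl.
rewrite -mul_mpolyC; apply: chainM; first exact: chainC.
rewrite mpolyXE_id; elim/big_ind: _ => [||i _]; [exact: chainC|exact: chainM|].
elim: (m i) => [|e IH]; first by rewrite expr0; apply: chainC.
by rewrite exprS; apply: chainM.
Qed.

End ChainRule.

Section CharZero.
Variable (K : fieldType).
Hypothesis charK : [pchar K] =i pred0.

Lemma natr_inj_char0 : injective (fun n : nat => n%:R : K).
Proof.
have H m n : (m <= n)%N -> m%:R = n%:R :> K -> m = n.
  move=> mn /eqP; rewrite eq_sym -subr_eq0 -natrB // ((pcharf0P _).1 charK) // subn_eq0 => ?.
  by apply/eqP; rewrite eqn_leq mn.
move=> m n /= E; case/orP: (leq_total m n) => /H; first exact.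
by move=> /(_ (esym E)).
Qed.

Lemma poly_eq0_infinite (p : {poly K}) : (forall t, p.[t] = 0) -> p = 0.
Proof.
move=> p0; apply/eqP/negPn/negP => pn0.
have := @max_poly_roots _ p (map (fun n : nat => n%:R) (iota 0 (size p))) pn0.
rewrite map_inj_uniq ?iota_uniq; last exact: natr_inj_char0.
rewrite size_map size_iota ltnn => H; suff: false by []. apply: H => //.
by apply/allP => x _; rewrite rootE p0.
Qed.

Lemma msize_mderiv n i (p : {mpoly K[n]}) d :
  (msize p <= d.+1)%N -> (msize p^`M(i) <= d)%N.
Proof.
move=> pd; rewrite msizeE; apply/bigmax_leqP_seq => m; rewrite mcoeff_msupp mcoeff_deriv => nz _.
have : m \in msupp p^`M(i) by rewrite mcoeff_msupp mcoeff_deriv.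
have /msize_mdeg_lt : (m + U_(i))%MM \in msupp p.
  by rewrite mcoeff_msupp; apply: contraNneq nz => ->; rewrite mul0rn.
by rewrite mdegD mdeg1 addn1 => /leq_trans /(_ pd).
Qed.

Lemma mderiv_eq0_const n (p : {mpoly K[n]}) :
  (forall i, p^`M(i) = 0) -> p = (p@_0)%:MP.
Proof.
move=> dp; apply/mpolyP => m; rewrite mcoeffC eq_sym.
have [->|] := eqVneq m 0%MM; first by rewrite mulr1.
rewrite mulr0 -mdeg_eq0 mdegE sum_nat_eq0 negb_forall => /existsP[i /= mi].
have /mpolyP/(_ (m - U_(i))%MM) := dp i; rewrite mcoeff_deriv mcoeff0 submK; last first.
  by apply/mnm_lepP => l; rewrite mnm1E; case: (i =P l) => // <-; rewrite lt0n.
by move/eqP; rewrite -mulr_natr mulf_eq0 ((pcharf0P _).1 charK) //= orbF => /eqP.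
Qed.

Lemma horner_mmap n (h : 'I_n -> {poly K}) (p : {mpoly K[n]}) t :
  (mmap (@polyC K) h p).[t] = p.@[fun i => (h i).[t]].
Proof.
rewrite mevalE /mmap horner_sum; apply: eq_bigr => m _.
rewrite hornerM hornerC /mmap1; congr (_ * _).
by rewrite horner_prod; apply: eq_bigr => i _; rewrite horner_exp.
Qed.

(** By induction on the size: restricted to the line through v in the i-th
    direction, p is a univariate polynomial without nonzero values, so its
    i-th partial derivative vanishes everywhere too and is zero by induction;
    in characteristic zero p is then constant. *)
Lemma mpoly_eq0_infinite n (p : {mpoly K[n]}) :
  (forall v, p.@[v] = 0) -> p = 0.
Proof.
have [d] := ubnP (msize p); elim: d p => // d IH p pd p0.
suff dp i : p^`M(i) = 0.
  have := p0 (fun=> 0); rewrite [p in p.@[_]]mderiv_eq0_const // mevalC => c0.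
  by rewrite [p]mderiv_eq0_const // c0 mpolyC0.
case: d IH pd => [|d] IH pd.
  by move: pd; rewrite ltnS leqn0 msize_poly_eq0 => /eqP->; rewrite mderiv0.
apply: IH => [|v]; first exact: msize_mderiv.
pose h l : {poly K} := (v l)%:P + (l == i)%:R *: 'X.
have q0 : mmap (@polyC K) h p = 0.
  by apply: poly_eq0_infinite => t; rewrite horner_mmap p0.
have := @derivation_mmap _ _ _ (@polyC K) h (@deriv K) (@derivM K) (@derivC K) p.
rewrite /= q0 deriv0 => /esym /(congr1 (fun q => q.[0])).
rewrite horner_sum (bigD1 i) //= big1 => [|l li].
  rewrite hornerM horner_mmap derivD derivC derivZ derivX add0r eqxx scale1r.
  rewrite hornerC mulr1 horner0 addr0 => <-.
  by apply: meval_eq => l; rewrite !hornerE.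
by rewrite hornerM derivD derivC derivZ derivX add0r (negbTE li) scale0r horner0 mulr0.
Qed.

End CharZero.

(** * Algebraic dependence *)

(** Multi-indices are plain sequences here: the list serves both for exponents
    of monomials and for positions in a tensor, and its recursive form is what
    inductions on the number of variables or factors use. *)
Fixpoint box (ms : seq nat) : seq (seq nat) :=
  if ms is m :: ms' then [seq c :: x | c <- iota 0 m, x <- box ms'] else [:: [::]].

Lemma size_box ms : size (box ms) = (\prod_(m <- ms) m)%N.
Proof.
elim: ms => [|m ms IH]; first by rewrite big_nil.
by rewrite big_cons /= size_allpairs size_iota IH.
Qed.

Lemma mem_box ms x :
  (x \in box ms) = (size x == size ms) && all2 ltn x ms.
Proof.
elim: ms x => [|m ms IH] [|c x] //=.
  by apply/negP => /allpairsP[[? ?] [_ _]].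
rewrite eqSS andbCA -IH.
apply/allpairsP/andP => [[[a y] /= [+ Hy [-> ->]]]|[cm xm]].
  by rewrite mem_iota /= add0n.
by exists (c, x); rewrite mem_iota.
Qed.

Lemma box_uniq ms : uniq (box ms).
Proof.
elim: ms => //= m ms IH; apply: allpairs_uniq => //; first exact: iota_uniq.
by move=> [a x] [b y] _ _ /= [-> ->].
Qed.

Lemma big_box_cons (V : nmodType) m ms (F : seq nat -> V) :
  \sum_(x <- box (m :: ms)) F x = \sum_(0 <= c < m) \sum_(x <- box ms) F (c :: x).
Proof.
rewrite /= big_flatten big_map /index_iota subn0.
by apply: eq_bigr => c _; rewrite big_map.
Qed.

Section Monomials.
Variables (R : comNzRingType).

Definition mono (fs : seq R) (es : seq nat) : R :=
  \prod_(p <- zip fs es) p.1 ^+ p.2.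

Lemma mono_cons f fs a es : mono (f :: fs) (a :: es) = f ^+ a * mono fs es.
Proof. by rewrite /mono big_cons. Qed.

End Monomials.

Lemma rmorph_mono (R S : comNzRingType) (phi : {rmorphism R -> S}) fs es :
  phi (mono fs es) = mono (map phi fs) es.
Proof.
elim: fs es => [|f fs IH] [|a es]; rewrite /mono /= ?big_nil ?rmorph1 //.
by rewrite !big_cons rmorphM rmorphXn; congr (_ * _); exact: IH.
Qed.

Lemma mem_box_nseq D e x :
  (x \in box (nseq D e)) = (size x == D) && all (fun a => a < e)%N x.
Proof.
rewrite mem_box size_nseq; case: eqP => //= <-.
by elim: x => //= a x ->.
Qed.

Lemma msizeM_le_pred n (K : fieldType) (p q : {mpoly K[n]}) :
  (msize (p * q) <= (msize p + msize q).-1)%N.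
Proof.
have [->|p0] := eqVneq p 0; first by rewrite mul0r msize0.
have [->|q0] := eqVneq q 0; first by rewrite mulr0 msize0.
by rewrite msizeM.
Qed.

Lemma mono_msize n (K : fieldType) d e (fs : seq {mpoly K[n]}) es :
  (forall f, f \in fs -> msize f <= d.+1)%N ->
  (forall a, a \in es -> a <= e)%N ->
  (msize (mono fs es) <= (size fs * (d * e)).+1)%N.
Proof.
elim: fs es => [|f fs IH] es fsd ese.
  by rewrite /mono; case: es ese => *; rewrite big_nil msize1.
case: es ese => [|a es] ese.
  by rewrite /mono /= big_nil msize1.
rewrite mono_cons.
have fd : (msize f <= d.+1)%N by apply: fsd; rewrite mem_head.
have ae : (a <= e)%N by apply: ese; rewrite mem_head.
have fX b : (msize (f ^+ b) <= (d * b).+1)%N.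
  elim: b => [|b IHb]; first by rewrite expr0 msize1 muln0.
  rewrite exprS (leq_trans (msizeM_le_pred _ _)) //.
  by rewrite mulnS; move: (d * b)%N (msize f) (msize (f ^+ b)) fd IHb => *; lia.
have {}IH : (msize (mono fs es) <= (size fs * (d * e)).+1)%N.
  by apply: IH => g gi; [apply: fsd|apply: ese]; rewrite inE gi orbT.
rewrite (leq_trans (msizeM_le_pred _ _)) //.
have := fX a; have : (d * a <= d * e)%N by rewrite leq_mul2l ae orbT.
rewrite /= mulSn; move: (d * a)%N (d * e)%N (size fs * _)%N (msize _) (msize _) IH => *; lia.
Qed.

Lemma linear_dependence (K : fieldType) (T : eqType) (s : seq T) (U : finType)
    (A : T -> U -> K) :
  uniq s -> (#|U| < size s)%N ->
  exists2 c : T -> K, exists2 x, x \in s & c x != 0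
                    & forall u, \sum_(x <- s) c x * A x u = 0.
Proof.
move=> su sU.
have [x0 _] : exists x0, x0 \in s by case: s sU {su} => // x s; exists x; rewrite mem_head.
pose M := \matrix_(i < size s, j < #|U|) A (nth x0 s i) (enum_val j).
have : kermx M != 0.
  by rewrite -mxrank_eq0 mxrank_ker subn_eq0 -ltnNge (leq_ltn_trans (rank_leq_col _)).
case/rowV0Pn => v /sub_kermxP vM v0.
pose c x := if insub (index x s) is Some i then v 0 i else 0.
have cE (i : 'I_(size s)) : c (nth x0 s i) = v 0 i.
  by rewrite /c index_uniq // valK.
exists c => [|u].
  have [i vi] : exists i, v 0 i != 0.
    apply/existsP; apply: contraNT v0; rewrite negb_exists => /forallP H.
    by apply/eqP/rowP => i; rewrite mxE; apply/eqP/negPn.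
  by exists (nth x0 s i); rewrite ?mem_nth ?cE.
rewrite (big_nth x0) big_mkord.
transitivity ((v *m M) 0 (enum_rank u)); last by rewrite vM mxE.
by rewrite mxE; apply: eq_bigr => i _; rewrite mxE enum_rankK cE.
Qed.

(** Among the products of powers of the D members of gs with exponents below
    e there are e ^ D candidates, whose degrees grow linearly in e, so that they
    live in a space of dimension O(e ^ r); for r < D and e large they cannot be
    linearly independent. *)
Lemma algebraic_dependence (K : fieldType) r (gs : seq {mpoly K[r]}) :
  (r < size gs)%N ->
  exists e, exists2 c : seq nat -> K,
    exists2 es, es \in box (nseq (size gs) e) & c es != 0 &
    \sum_(es <- box (nseq (size gs) e)) c es *: mono gs es = 0.
Proof.
move=> rD; set D := size gs in rD *.
pose d := \max_(g <- gs) msize g.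
(* The exponents of the variables in the products stay below B, which is
   at most (D d + 1) e, and ((D d + 1) e) ^ r < e ^ (r + 1) for this e. *)
pose e := ((D * d).+1 ^ r).+1; exists e.
pose B := (D * (d * e)).+1.
have BE : (B ^ r < e ^ D)%N.
  apply: (@leq_trans (e ^ r.+1)); last by rewrite leq_pexp2l.
  apply: (@leq_ltn_trans (((D * d).+1 * e) ^ r)).
    have : (B <= (D * d).+1 * e)%N.
      by rewrite mulSn -mulnA addnC /B -addn1 leq_add2l.
    by case: (r) => [|r']; [rewrite !expn0 | rewrite leq_exp2r].
  by rewrite expnMn expnS ltn_pmul2r ?expn_gt0.
pose U := {ffun 'I_r -> 'I_B}.
pose A es (u : U) := (mono gs es)@_[multinom (u i : nat) | i < r].
have [|c cn0 cA] := @linear_dependence K _ (box (nseq D e)) U A (box_uniq _).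
  by rewrite card_ffun !card_ord size_box big_nseq iter_muln_1.
exists c => //; apply/mpolyP => m; rewrite mcoeff0 raddf_sum /=.
have [mB|] := boolP [forall i, m i < B]%N.
  pose u : U := [ffun i => inord (m i)].
  have -> : m = [multinom (u i : nat) | i < r].
    by apply/mnmP => i; rewrite mnmE ffunE inordK // (forallP mB i).
  by rewrite -[RHS](cA u); apply: eq_bigr => es _; rewrite mcoeffZ.
rewrite negb_forall => /existsP[i]; rewrite -leqNgt => mi.
rewrite big_seq big1 // => es; rewrite mem_box_nseq => /andP[_ /allP es_e].
rewrite mcoeffZ memN_msupp_eq0 ?mulr0 //; apply: msize_mdeg_ge.
apply: (leq_trans (@mono_msize _ _ d e gs es _ _)) => [g gi|a /es_e/ltnW //|].
- by rewrite leqW // /d (big_rem g) /= ?leq_maxl //.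
- by apply: leq_trans mi _; rewrite mdegE (bigD1 i) //=; exact: leq_addr.
Qed.

(** Polynomial relations are written as sums over boxes of exponents, because
    the coefficient of a first exponent can then be split off by
    big_box_cons. *)
Definition alg_indep_mod (K : fieldType) n (P : {pred {mpoly K[n]}}) (gs : seq {mpoly K[n]}) :=
  forall e (c : seq nat -> K),
    \sum_(es <- box (nseq (size gs) e)) c es *: mono gs es \in P ->
  {in box (nseq (size gs) e), forall es, c es = 0}.

Lemma alg_indep_le_vars (K : fieldType) r (gs : seq {mpoly K[r]}) :
  alg_indep_mod (pred1 0) gs -> (size gs <= r)%N.
Proof.
move=> indep; rewrite leqNgt; apply/negP => /algebraic_dependence [e [c [es es_e c0] rel]].
by case/eqP: c0; apply: indep es_e; rewrite inE; apply/eqP.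
Qed.

(** Sort a relation among f_0, f_1, ... modulo P_0 by powers of f_0: its
    constant term lies in P_1, since f_0 does, so it is a relation among the
    remaining f_i modulo P_1 and vanishes by induction; the rest is divisible
    by f_0, which is not in the prime P_0, and can be divided by it. *)
Lemma alg_indep_mod_chain (K : fieldType) n (P : nat -> {pred {mpoly K[n]}})
    (fs : seq {mpoly K[n]}) :
  (forall i, (i <= size fs)%N -> idealr_closed (P i) /\ prime_idealr_closed (P i)) ->
  (forall i, (i < size fs)%N -> {subset P i <= P i.+1}) ->
  (forall i, (i < size fs)%N -> fs`_i \in P i.+1 /\ fs`_i \notin P i) ->
  alg_indep_mod (P 0%N) fs.
Proof.
elim: fs P => [|f fs IH] P idP subP fsP e c.
  have [[P0 P1 PD] _] := idP 0%N (leqnn _).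
  rewrite /= big_seq1 /mono big_nil => cP es; rewrite inE => /eqP->.
  apply: contraNeq P1 => c0; have := PD ((c [::])^-1)%:MP _ _ cP P0.
  by rewrite addr0 mul_mpolyC scalerA mulVf ?scale1r.
have {}IH : alg_indep_mod (P 1%N) fs.
  exact: (IH (P \o S) (fun i => idP i.+1) (fun i => subP i.+1) (fun i => fsP i.+1)).
have [[P00 P01 P0D] P0prime] := idP 0%N (leq0n _).
have [[P10 P11 P1D] _] := idP 1%N (ltn0Sn _).
have [fP1 fP0] := fsP 0%N (ltn0Sn _).
have P1B : forall u v, u + f * v \in P 1%N -> u \in P 1%N.
  move=> u v uv; have -> : u = - v * f + (u + f * v) by ring.
  exact: P1D.
have -> : nseq (size (f :: fs)) e = e :: nseq (size fs) e by [].
rewrite big_box_cons.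
pose g a := \sum_(x <- box (nseq (size fs) e)) c (a :: x) *: mono fs x.
rewrite (eq_bigr (fun a => f ^+ a * g a)) => [|a _]; last first.
  by rewrite mulr_sumr; apply: eq_bigr => x _; rewrite mono_cons scalerAr.
have gP1 a : g a \in P 1%N -> g a = 0.
  move=> /IH c0; rewrite /g big_seq big1 // => x /c0 ->; exact: scale0r.
(* g a collects the terms in which f has exponent a; the shift by b lets the
   induction divide by f. *)
suff g0 m b : \sum_(0 <= a < m) f ^+ a * g (b + a)%N \in P 0%N ->
    forall a, (a < m)%N -> g (b + a)%N = 0.
  move=> /(g0 e 0%N) H es; rewrite mem_box; case: es => //= a es.
  rewrite eqSS andbCA -mem_box => /andP[/H ga es_e].
  by apply: (IH e (fun x => c (a :: x))) => //; rewrite -/(g a) -[a]add0n ga.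
elim: m b => // m IHm b.
rewrite big_nat_recl // expr0 mul1r.
rewrite (eq_bigr (fun a => f * (f ^+ a * g (b.+1 + a)%N))) => [|a _]; last first.
  by rewrite exprS mulrA addnS addSn.
rewrite -mulr_sumr => S0.
have gb : g (b + 0)%N = 0 by apply: gP1; apply: P1B (subP 0%N _ _ S0).
move: S0; rewrite gb add0r => /P0prime; rewrite (negbTE fP0) /= => /IHm gSb [|a] am //.
by rewrite addnS -addSn gSb.
Qed.

(** * Upper bound for chains of homogeneous primes *)

Section UpperBound.
Variables (K : fieldType) (N : nat).
Implicit Types (Z : 'rV[K]_N -> Prop) (P : {pred {mpoly K[N]}}).

Lemma homogeneous_ideal_const0 P f : homogeneous_ideal P -> f \in P -> f@_0 = 0.
Proof.
move=> [[P0 P1 PD] hP] /hP /(_ 0%N).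
have -> : pihomog mdeg 0 f = (f@_0)%:MP.
  apply/mpolyP => m; rewrite mcoeffC /pihomog raddf_sum /= eq_sym.
  have [->|m0] := eqVneq m 0%MM.
    rewrite mulr1; have [f0|f0] := boolP (0%MM \in msupp f).
      rewrite -big_filter (bigD1_seq 0%MM) ?filter_uniq ?msupp_uniq ?mem_filter ?mdeg0 ?f0 //=.
      rewrite mcoeffZ mcoeffX eqxx mulr1 big1 ?addr0 // => m' m'0.
      by rewrite mcoeffZ mcoeffX (negbTE m'0) mulr0.
    rewrite memN_msupp_eq0 // big_seq_cond big1 // => m' /andP[m'f].
    by rewrite mdeg_eq0 => /eqP m'0; rewrite m'0 (negbTE f0) in m'f.
  rewrite mulr0 big1 // => m'; rewrite mdeg_eq0 => /eqP->.
  by rewrite mcoeffZ mcoeffX eq_sym (negbTE m0) mulr0.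
move=> fP; apply: contraNeq P1 => c0.
have := PD (f@_0%MM)^-1%:MP _ _ fP P0.
by rewrite addr0 mul_mpolyC -[(f@_0)%:MP]mulr1 mul_mpolyC scalerA mulVf ?scale1r.
Qed.

(** A chain of d + 1 homogeneous primes that avoid the irrelevant ideal is
    prolonged by the irrelevant ideal, so it yields d + 1 polynomials that are
    algebraically independent modulo P_0.  As P_0 contains the kernel of
    f |-> f(psi), so are their images in r variables. *)
Lemma prime_chain_lt_vars Z r (psi : N.-tuple {mpoly K[r]}) d :
  (forall P, proj_prime P -> contains_ideal_of Z P ->
     forall f, f \mPo psi = 0 -> f \in P) ->
  prime_chain Z d -> (d < r)%N.
Proof.
move=> kerP [P [PP PS]].
have /fin_all_exists[f fP] (i : 'I_d) : exists g,
    g \in P (lift ord0 i) /\ g \notin P (widen_ord (leqnSn d) i).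
  have [|_] := PS (widen_ord (leqnSn d) i) (lift ord0 i); first by rewrite /= /bump.
  move=> /not_all_ex_not[g Hg]; exists g.
  by have [gi gn] := imply_to_and _ _ Hg; split=> //; apply/negP.
have [[_ _ [i0 Xi0]] _] := PP ord_max.
(* Q prolongs the chain by the irrelevant ideal, and the variable 'X_i0 is in
   the latter but not in the last prime of the chain. *)
pose irr : {pred {mpoly K[N]}} := [pred g | g@_0 == 0].
pose Q i := if (i <= d)%N then P (inord i) else irr.
pose fs := mkseq (fun i => if insub i is Some i' then f i' else 'X_i0) d.+1.
have szfs : size fs = d.+1 by rewrite size_mkseq.
have PQ (i : 'I_d.+1) : Q i = P i.
  by rewrite /Q -ltnS ltn_ord; congr P; apply: val_inj; rewrite /= inordK.
have QP i : (i <= d)%N -> Q i = P (inord i) by rewrite /Q => ->.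
have indep : alg_indep_mod (Q 0%N) fs.
  apply: alg_indep_mod_chain; rewrite szfs.
  - move=> i _; rewrite /Q; case: ifP => [_|_].
      by have [[[? _] ? _] _] := PP (inord i).
    split; last first.
      by move=> u v; rewrite !inE rmorphM mulf_eq0.
    split; rewrite ?inE ?mcoeff0 ?mcoeff1 ?eqxx ?oner_eq0 // => a u v.
    by rewrite !inE mcoeffD rmorphM /= => /eqP-> /eqP->; rewrite mulr0 addr0.
  - move=> i; rewrite ltnS leq_eqVlt => /orP[/eqP->|id].
      rewrite (PQ ord_max) /Q ltnn => g gP; rewrite inE; apply/eqP.
      by have [[hP _ _] _] := PP ord_max; apply: homogeneous_ideal_const0 hP gP.
    rewrite !QP //; last exact: ltnW.
    by apply: (PS _ _ _).1; rewrite !inordK // ltnS // ltnW.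
  - move=> i; rewrite ltnS leq_eqVlt => /orP[/eqP->|id].
      rewrite (PQ ord_max) /Q ltnn nth_mkseq // insubF ?ltnn //.
      by split=> //; rewrite inE mcoeffX mnm1_eq0.
    rewrite nth_mkseq ?(leqW id) // insubT.
    by have := fP (Ordinal id); rewrite -!PQ.
have : alg_indep_mod (pred1 0) (map (comp_mpoly psi) fs).
  move=> e c; rewrite size_map inE => /eqP rel; apply: indep.
  have [PP0 cP0] := PP ord0; rewrite (PQ ord0); apply: kerP => //.
  rewrite raddf_sum /= -[RHS]rel; apply: eq_bigr => es _.
  by rewrite comp_mpolyZ rmorph_mono.
by move/alg_indep_le_vars; rewrite size_map szfs.
Qed.
End UpperBound.

(** * The Jacobian criterion *)

Section Jacobian.
Variable (K : fieldType).

Lemma mderiv_comp n r (lq : n.-tuple {mpoly K[r]}) l (p : {mpoly K[n]}) :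
  (p \mPo lq)^`M(l) = \sum_i (p^`M(i) \mPo lq) * (tnth lq i)^`M(l).
Proof.
exact: (@derivation_mmap K n _ (@mpolyC r K) _ (mderiv l) (mderivM l) (mderivC l)).
Qed.

Definition jacobian n r (g : n.-tuple {mpoly K[r]}) (v : 'I_r -> K) : 'M[K]_(r, n) :=
  \matrix_(l, i) ((tnth g i)^`M(l)).@[v].

Lemma jacobian_comp n r m (g : n.-tuple {mpoly K[r]}) (h : r.-tuple {mpoly K[m]}) v :
  jacobian [tuple (tnth g i) \mPo h | i < n] v =
    jacobian h v *m jacobian g (fun i => (tnth h i).@[v]).
Proof.
apply/matrixP => l i; rewrite !mxE tnth_mktuple mderiv_comp raddf_sum /=.
by apply: eq_bigr => j _; rewrite mevalM comp_mpoly_meval !mxE mulrC.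
Qed.

Hypothesis charK : [pchar K] =i pred0.

(** Differentiating F(g) = 0 shows that the partial derivatives of F at g are
    killed by a matrix of nonzero determinant; they are smaller relations, so
    they are zero by induction, and F is a constant. *)
Lemma jacobian_injective r (g : r.-tuple {mpoly K[r]}) v (F : {mpoly K[r]}) :
  jacobian g v \in unitmx -> F \mPo g = 0 -> F = 0.
Proof.
move=> Jv; have [d] := ubnP (msize F); elim: d F => // d IH F Fd F0.
suff dF i : F^`M(i) = 0.
  by rewrite (mderiv_eq0_const charK dF) in F0 *; rewrite comp_mpolyC in F0.
pose M : 'M[{mpoly K[r]}]_r := \matrix_(l, i) (tnth g i)^`M(l).
pose u : 'cV[{mpoly K[r]}]_r := \col_i (F^`M(i) \mPo g).
have Mu : M *m u = 0.
  apply/colP => l; rewrite !mxE; transitivity ((F \mPo g)^`M(l)).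
    by rewrite mderiv_comp; apply: eq_bigr => j _; rewrite !mxE mulrC.
  by rewrite F0 mderiv0.
have detM : \det M != 0.
  apply: contraTneq Jv => M0; rewrite unitmxE unitfE negbK.
  have -> : jacobian g v = map_mx (meval v) M by apply/matrixP => l j; rewrite !mxE.
  by rewrite det_map_mx M0 rmorph0.
have u0 : u = 0.
  apply/colP => l; rewrite [RHS]mxE; apply/eqP; rewrite -(mulrI_eq0 _ (lregP detM)); apply/eqP.
  have /colP/(_ l) := congr1 (mulmx (\adj M)) Mu.
  by rewrite mulmxA mul_adj_mx mulmx0 mul_scalar_mx [LHS]mxE [RHS]mxE.
case: d IH Fd => [|d] IH Fd.
  by move: Fd; rewrite ltnS leqn0 msize_poly_eq0 => /eqP->; rewrite mderiv0.
apply: IH; first exact: msize_mderiv.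
by have /colP/(_ i) := u0; rewrite !mxE.
Qed.

End Jacobian.

(** * Lower bound: a chain of primes from the rank of a Jacobian matrix *)

Section Restriction.
Variable (K : fieldType).

Definition linear_forms j M (L : 'M[K]_(j, M)) : M.-tuple {mpoly K[j]} :=
  [tuple \sum_l L l m *: 'X_l | m < M].

(** The polynomial map Phi on the row space of L, in the coordinates given by
    the rows of L. *)
Definition restrict N M j (Phi : N.-tuple {mpoly K[M]}) (L : 'M[K]_(j, M)) :
    N.-tuple {mpoly K[j]} :=
  [tuple (tnth Phi t) \mPo linear_forms L | t < N].

Lemma meval_linear_forms j M (L : 'M[K]_(j, M)) (y : 'I_j -> K) m :
  (tnth (linear_forms L) m).@[y] = ((\row_l y l) *m L) 0 m.
Proof.
rewrite tnth_mktuple raddf_sum mxE; apply: eq_bigr => l _ /=.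
by rewrite mevalZ mevalXU mxE mulrC.
Qed.

Lemma meval_restrict N M j (Phi : N.-tuple {mpoly K[M]}) (L : 'M[K]_(j, M)) y t :
  (tnth (restrict Phi L) t).@[y] = (tnth Phi t).@[((\row_l y l) *m L) 0].
Proof.
rewrite tnth_mktuple comp_mpoly_meval.
apply: meval_eq => m; exact: meval_linear_forms.
Qed.

Lemma jacobian_restrict N M j (Phi : N.-tuple {mpoly K[M]}) (L : 'M[K]_(j, M)) y :
  jacobian (restrict Phi L) y = L *m jacobian Phi (((\row_l y l) *m L) 0).
Proof.
rewrite jacobian_comp; congr (_ *m _).
  apply/matrixP => l m; rewrite mxE tnth_mktuple.
  suff -> : (\sum_l' L l' m *: 'X_l')^`M(l) = (L l m)%:MP by rewrite mevalC.
  rewrite (raddf_sum (mderiv l)) (bigD1 l) //= big1 => [|l' l'l].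
    by rewrite mderivZ mderiv_var eqxx addr0 -mul_mpolyC mulr1.
  by rewrite mderivZ mderiv_var (negbTE l'l) mpolyC0 scaler0.
apply/matrixP => m i; rewrite !mxE; apply: meval_eq => l; exact: meval_linear_forms.
Qed.

(** Homogeneity is only ever used through values, where it is immediate for
    the parametrization and for its restrictions. *)
Definition eval_homog N M k (Phi : N.-tuple {mpoly K[M]}) :=
  forall c v i, (tnth Phi i).@[fun m => c * v m] = c ^+ k * (tnth Phi i).@[v].

Lemma eval_homog_restrict N M j k (Phi : N.-tuple {mpoly K[M]}) (L : 'M[K]_(j, M)) :
  eval_homog k Phi -> eval_homog k (restrict Phi L).
Proof.
move=> hPhi c v i; rewrite !meval_restrict -hPhi.
apply: meval_eq => m; rewrite !mxE mulr_sumr.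
by apply: eq_bigr => l _; rewrite !mxE mulrA.
Qed.

Lemma meval_scale_homog n e (f : {mpoly K[n]}) c v :
  f \is e.-homog -> f.@[fun i => c * v i] = c ^+ e * f.@[v].
Proof.
move=> /dhomogP fe; rewrite !mevalE mulr_sumr big_seq [RHS]big_seq.
apply: eq_bigr => m /fe fm; have {fm} <- : mdeg m = e := fm.
rewrite mulrCA; congr (_ * _); rewrite mdegE expr_sum -big_split /=.
by apply: eq_bigr => i _; rewrite exprMn.
Qed.

Hypothesis charK : [pchar K] =i pred0.

(** The values of f along the curve c |-> c ^ k w form a polynomial in c whose
    coefficients are the values of the homogeneous components of f at w. *)
Lemma pihomog_vanish n (f : {mpoly K[n]}) k w : (0 < k)%N ->
  (forall c, f.@[fun i => c ^+ k * w i] = 0) -> forall e, (pihomog mdeg e f).@[w] = 0.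
Proof.
move=> k0 f0 e.
pose q := \sum_(d < msize f) (pihomog mdeg d f).@[w] *: 'X^(k * d).
have q0 : q = 0.
  apply: (poly_eq0_infinite charK) => c; rewrite -(f0 c).
  rewrite [in RHS](pihomog_partitionE (mf := mdeg) (leqnn (msize f))) horner_sum raddf_sum /=.
  apply: eq_bigr => d _; rewrite hornerZ hornerXn (meval_scale_homog _ _ (pihomogP _ _ _)).
  by rewrite mulrC exprM.
have [ef|fe] := ltnP e (msize f).
  have := congr1 (fun p : {poly K} => p`_(k * e)) q0.
  rewrite coef0 coef_sum (bigD1 (Ordinal ef)) //= big1 => [|d de].
    by rewrite coefZ coefXn eqxx mulr1 addr0.
  move: de; rewrite -val_eqE /= coefZ coefXn eqn_pmul2l // eq_sym => /negbTE->.
  by rewrite mulr0.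
rewrite /pihomog big_seq_cond big1 ?meval0 // => m /andP[/msize_mdeg_lt mf /eqP me].
by move: mf; rewrite me ltnNge fe.
Qed.

Definition kernel N j (Psi : N.-tuple {mpoly K[j]}) : {pred {mpoly K[N]}} :=
  [pred f | f \mPo Psi == 0].

Lemma kernelP N j (Psi : N.-tuple {mpoly K[j]}) f :
  reflect (forall y, f.@[fun t => (tnth Psi t).@[y]] = 0) (f \in kernel Psi).
Proof.
apply: (iffP eqP) => [f0 y|f0]; first by rewrite -comp_mpoly_meval f0 meval0.
by apply: (mpoly_eq0_infinite charK) => y; rewrite comp_mpoly_meval.
Qed.

(** The kernel is prime because polynomials form a domain, and homogeneous
    because the image of a homogeneous map is a cone. *)
Lemma proj_prime_kernel N j k (Psi : N.-tuple {mpoly K[j]}) y t : (0 < k)%N ->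
  eval_homog k Psi -> (tnth Psi t).@[y] != 0 -> proj_prime (kernel Psi).
Proof.
move=> k0 hPsi yt; split.
- split; first split.
  + by rewrite inE comp_mpoly0.
  + by rewrite inE comp_mpoly1 oner_eq0.
  + by move=> a u v; rewrite !inE comp_mpolyD rmorphM /= => /eqP-> /eqP->; rewrite mulr0 addr0.
  move=> f /kernelP f0 e; apply/kernelP => v; apply: (pihomog_vanish k0) => c.
  rewrite -[RHS](f0 (fun m => c * v m)); apply: meval_eq => i; exact/esym/hPsi.
- by move=> u v; rewrite !inE rmorphM mulf_eq0.
exists t; apply: contraNN yt => /kernelP /(_ y).
by rewrite mevalXU => ->.
Qed.

Lemma jacobian_alg_indep N j (Psi : N.-tuple {mpoly K[j]}) y :
  row_free (jacobian Psi y) ->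
  exists sel : 'I_j -> 'I_N, forall F : {mpoly K[j]},
    F \mPo [tuple 'X_(sel s) | s < j] \in kernel Psi -> F = 0.
Proof.
move=> Jfree; have Jfull : row_full (jacobian Psi y)^T by rewrite /row_full mxrank_tr.
pose sel := fullrankfun Jfull; exists sel => F /kernelP F0.
apply: (@jacobian_injective _ charK _ [tuple (tnth Psi (sel s)) | s < j] y).
  rewrite -unitmx_tr; apply: etrans (fullrowsub_unit Jfull); congr (_ \in unitmx).
  by apply/matrixP => s l; rewrite !mxE tnth_mktuple.
apply: (mpoly_eq0_infinite charK) => v; rewrite -[RHS](F0 v) !comp_mpoly_meval.
by apply: meval_eq => s; rewrite !tnth_mktuple mevalXU.
Qed.

Lemma sum_mono_inj n e (c : seq nat -> K) :
  \sum_(es <- box (nseq n e)) c es *: mono (codom (fun s => 'X_s : {mpoly K[n]})) es = 0 ->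
  {in box (nseq n e), forall es, c es = 0}.
Proof.
set Xs := codom _ => S0 es es_e.
pose mn (es : seq nat) : 'X_{1..n} := [multinom nth 0%N es s | s < n].
have monoE x : x \in box (nseq n e) -> mono Xs x = 'X_[mn x].
  rewrite mem_box_nseq => /andP[/eqP sx _].
  rewrite /mono (big_nth (0, 0%N)) big_mkord size_zip size_codom card_ord sx minnn.
  rewrite [RHS]mpolyXE_id; apply: eq_bigr => s _; rewrite nth_zip ?size_codom ?card_ord //= mnmE.
  by rewrite (nth_map s) ?size_enum_ord // nth_ord_enum.
have := congr1 (mcoeff (mn es)) S0.
rewrite raddf_sum mcoeff0 /= (bigD1_seq es) ?box_uniq //= monoE // mcoeffZ mcoeffX eqxx mulr1.
rewrite big_seq_cond big1 ?addr0 // => x /andP[x_e xes].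
rewrite mcoeffZ monoE // mcoeffX; case: eqP => [E|]; last by rewrite mulr0.
case/eqP: xes; apply: (@eq_from_nth _ 0%N).
  by move: x_e es_e; rewrite !mem_box_nseq => /andP[/eqP-> _] /andP[/eqP->].
move=> i; move: x_e; rewrite !mem_box_nseq => /andP[/eqP-> _] ilt.
by have /mnmP/(_ (Ordinal ilt)) := E; rewrite !mnmE.
Qed.

Lemma comp_mpoly_sum n r (lq : n.-tuple {mpoly K[r]}) I (s : seq I) F :
  (\sum_(i <- s) F i) \mPo lq = \sum_(i <- s) (F i \mPo lq).
Proof. exact: (big_morph _ (comp_mpolyD lq) (comp_mpoly0 lq)). Qed.

(** Some j components of Psi are algebraically independent, and the
    corresponding components of Psi', being polynomials in fewer variables, are
    not; a relation among the latter separates the kernels. *)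
Lemma kernel_not_sub N j (Psi : N.-tuple {mpoly K[j]}) y
    j' (Psi' : N.-tuple {mpoly K[j']}) :
  row_free (jacobian Psi y) -> (j' < j)%N -> ~ {subset kernel Psi' <= kernel Psi}.
Proof.
move=> /jacobian_alg_indep[sel indep] j'j sub.
have : alg_indep_mod (pred1 0) (codom (fun s => tnth Psi' (sel s))).
  move=> e c; rewrite size_codom card_ord inE => /eqP S0; apply: sum_mono_inj.
  apply: indep; apply: sub; rewrite inE; apply/eqP; rewrite -[RHS]S0.
  rewrite (comp_mpoly_sum [tuple 'X_(sel s) | s < j]) (comp_mpoly_sum Psi').
  apply: eq_bigr => es _; rewrite /= !comp_mpolyZ !rmorph_mono /codom /image_mem -!map_comp.
  congr (_ *: mono _ es); apply: eq_map => s /=.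
  by rewrite comp_mpolyXU -tnth_nth tnth_mktuple comp_mpolyXU -tnth_nth.
by move/alg_indep_le_vars; rewrite size_codom card_ord leqNgt j'j.
Qed.

Lemma row_free_rowsub m n p (f : 'I_p -> 'I_m) (A : 'M[K]_(m, n)) :
  injective f -> row_free A -> row_free (rowsub f A).
Proof.
move=> f_inj /row_freeP[B AB]; apply/row_freeP; exists (colsub f B).
rewrite -mxsub_mul AB; apply/matrixP => i j.
by rewrite !mxE (inj_eq f_inj).
Qed.

(** The first j + 1 rows of L span the spaces of a flag, all of which contain
    the point row 0 L; restricting Phi to smaller spaces enlarges the kernel. *)
Theorem prime_chain_of_jacobian (N M k r : nat) (Z : 'rV[K]_N -> Prop)
    (Phi : N.-tuple {mpoly K[M]}) (L : 'M[K]_(r.+1, M)) :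
  (0 < k)%N -> eval_homog k Phi ->
  (forall e f, f \is e.-homog -> vanishes_on Z f -> f \in kernel Phi) ->
  row_free (L *m jacobian Phi (row 0 L 0)) ->
  (exists t, (tnth Phi t).@[row 0 L 0] != 0) ->
  prime_chain Z r.
Proof.
move=> k0 hPhi ZPhi Lfree [t0 Pt0].
pose Lj j : 'M[K]_(j.+1, M) := rowsub (fun l : 'I_j.+1 => inord l : 'I_r.+1) L.
pose Psi j := restrict Phi (Lj j).
have PsiE j y t : (tnth (Psi j) t).@[y] =
    (tnth Phi t).@[fun m => \sum_(l < j.+1) y l * L (inord l) m].
  by rewrite meval_restrict; apply: meval_eq => m; rewrite mxE; apply: eq_bigr => l _; rewrite !mxE.
pose e1 j (l : 'I_j.+1) : K := (l == ord0)%:R.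
have Le1 j : (\row_l e1 j l) *m Lj j = row 0 L.
  apply/rowP => m; rewrite mxE (bigD1 ord0) //= big1 => [|l l0].
    by rewrite !mxE /e1 eqxx mul1r addr0; congr (L _ m); apply: val_inj; rewrite /= inordK.
  by rewrite !mxE /e1 (negbTE l0) mul0r.
have Psit0 j : (tnth (Psi j) t0).@[e1 j] != 0 by rewrite meval_restrict Le1.
(* The i-th prime belongs to the space spanned by r - i + 1 rows; e1 gives the
   coordinates of the common point row 0 L in each of them. *)
exists (fun i : 'I_r.+1 => kernel (Psi (r - i)%N)); split.
  move=> i; split.
    exact: (proj_prime_kernel k0 (eval_homog_restrict _ hPhi) (Psit0 _)).
  move=> e f fe fZ; apply/kernelP => y.
  have /kernelP fP := ZPhi e f fe fZ.
  by under meval_eq => t do rewrite meval_restrict; apply: fP.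
move=> i i' ii'; have lt : (r - i' < r - i)%N by have := ltn_ord i'; lia.
split.
  move=> f /kernelP f0; apply/kernelP => y.
  pose y' (l : nat) := if insub l is Some l' then y l' else 0.
  rewrite -[RHS](f0 y'); apply: meval_eq => t; rewrite !PsiE; apply: meval_eq => m.
  transitivity (\sum_(l < (r - i').+1) y' l * L (inord l) m).
    by apply: eq_bigr => l _; rewrite /y' valK.
  rewrite (big_ord_widen (r - i).+1 (fun l => y' l * L (inord l) m)) 1?ltnW // big_mkcond.
  apply: eq_bigr => l _; case: ifP => // l_big.
  by rewrite /y' insubF ?mul0r.
apply: (@kernel_not_sub _ _ _ (e1 _)) => //.
rewrite jacobian_restrict Le1.
pose sel := fun l : 'I_(r - i).+1 => inord l : 'I_r.+1.
have selE : injective sel.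
  move=> l l' /(congr1 val).
  by rewrite /= !inordK ?(leq_trans (ltn_ord _)) ?ltnS ?leq_subr // => /val_inj.
by rewrite mul_rowsub_mx; apply: row_free_rowsub selE Lfree.
Qed.

End Restriction.

(** * The parametrization of secant varieties of Segre varieties *)

Lemma derivation_prod (R : comNzRingType) (D : {additive R -> R}) (I : eqType)
    (F : I -> R) (s : seq I) :
  (forall x y, D (x * y) = D x * y + x * D y) -> uniq s ->
  D (\prod_(i <- s) F i) = \sum_(i <- s) D (F i) * \prod_(l <- s | l != i) F l.
Proof.
move=> DM; elim: s => [_|i s IH /= /andP[is_ us]].
  rewrite !big_nil; have /eqP := DM 1 1.
  by rewrite !mulr1 !mul1r -subr_eq subrr eq_sym => /eqP.
rewrite !big_cons DM IH // eqxx /=; congr (_ * _ + _).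
  rewrite big_seq [RHS]big_seq_cond; apply: eq_bigl => l.
  by rewrite andbC; case: eqP => [->|]; rewrite ?(negbTE is_) ?andbF.
rewrite mulr_sumr; apply: eq_big_seq => j js.
rewrite big_cons; case: (eqVneq i j) is_ => [->|_ _]; first by rewrite js.
by rewrite mulrCA.
Qed.

(** Complete u A to r + 1 independent vectors of the row space of A, and lift
    the added ones. *)
Lemma exists_rows_through (K : fieldType) M N r (u : 'rV[K]_M) (A : 'M[K]_(M, N)) :
  u *m A != 0 -> (r < \rank A)%N ->
  exists2 L : 'M[K]_(r.+1, M), row 0 L = u & row_free (L *m A).
Proof.
move=> uA rA; pose W := (A :\: (u *m A))%MS.
have ruA : \rank (u *m A) = 1%N by rewrite rank_rV uA.
have rW : (r <= \rank W)%N.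
  have := mxrank_cap_compl A (u *m A).
  have -> : \rank (A :&: (u *m A)) = 1%N by rewrite (capmx_idPr (submxMl _ _)).
  by rewrite -/W; lia.
pose B := rowsub (widen_ord rW) (row_base W).
have Bfree : row_free B.
  apply: row_free_rowsub; last exact: row_base_free.
  by move=> i j /(congr1 val) /= /val_inj.
have BW : (B <= W)%MS by rewrite (submx_trans (rowsub_sub _ _)) // eq_row_base.
have /submxP[L' BE] : (B <= A)%MS by apply: submx_trans BW _; apply: diffmxSl.
exists (col_mx u L' : 'M_(1 + r, M)).
  by apply/rowP => j; rewrite !mxE; case: splitP => // i _; rewrite ord1.
rewrite /row_free (mul_col_mx u L' A) -BE -[\rank _](eqmx_rank (introT eqmxP (addsmxE (u *m A) B))).
rewrite mxrank_disjoint_sum.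
  by rewrite ruA (eqP Bfree).
apply/eqP; rewrite -submx0 capmxC (submx_trans (capmxS BW (submx_refl _))) //.
by rewrite capmx_diff.
Qed.

(** Dimensions are maxima of lengths of chains; that a chain of given length
    exists is not decidable. *)
Lemma exists_max (P : nat -> Prop) d0 r :
  P d0 -> (forall d, P d -> (d < r)%N) -> exists2 d, P d & forall d', P d' -> (d' <= d)%N.
Proof.
move=> Pd0; elim: r => [/(_ _ Pd0) //|r IH Pr].
have [Pr'|nPr] := classic (P r); first by exists r => // d' /Pr.
by apply: IH => d Pd; have := Pr _ Pd; rewrite ltnS leq_eqVlt => /orP[/eqP dr|//]; rewrite dr in Pd.
Qed.

Section Segre.
Variables (K : fieldType) (k : nat) (n : k.-tuple nat) (s : nat).
Hypothesis charK : [pchar K] =i pred0.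
Hypotheses (k_gt0 : (0 < k)%N) (s_gt0 : (0 < s)%N).

Notation N := #|{: multi_index n}|.

Definition param : finType := ('I_s * {i : 'I_k & 'I_(tnth n i).+1})%type.
Definition coordinate (j : 'I_s) (i : 'I_k) (c : 'I_(tnth n i).+1) : 'I_#|param| :=
  enum_rank ((j, Tagged (fun i => 'I_(tnth n i).+1) c) : param).

Definition factors := 'I_s -> forall i : 'I_k, 'rV[K]_(tnth n i).+1.
Definition param_of (A : factors) : 'rV[K]_#|param| :=
  \row_m (let: (j, x) := (enum_val m : param) in A j (tag x) 0 (tagged x)).
Definition factors_of (y : 'I_#|param| -> K) : factors :=
  fun j i => \row_c y (coordinate j c).

Definition segre_map : N.-tuple {mpoly K[#|param|]} :=
  [tuple \sum_j \prod_i 'X_(coordinate j ((enum_val t : multi_index n) i)) | t < N].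

Definition sum_pure (A : factors) : tensor_space K n := \sum_j pure_tensor (A j).

Lemma coordinateK A j i (c : 'I_(tnth n i).+1) : param_of A 0 (coordinate j c) = A j i 0 c.
Proof. by rewrite mxE enum_rankK. Qed.

Lemma meval_segre_map y t : (tnth segre_map t).@[y] = sum_pure (factors_of y) 0 t.
Proof.
rewrite tnth_mktuple raddf_sum summxE /=; apply: eq_bigr => j _.
rewrite rmorph_prod mxE; apply: eq_bigr => i _ /=.
by rewrite mevalXU mxE.
Qed.

Lemma sum_pure_param A t : (tnth segre_map t).@[param_of A 0] = sum_pure A 0 t.
Proof.
rewrite meval_segre_map !summxE; apply: eq_bigr => j _; rewrite !mxE.
by apply: eq_bigr => i _; rewrite mxE coordinateK.
Qed.

Lemma eval_homog_segre_map : eval_homog k segre_map.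
Proof.
move=> c v t; rewrite !meval_segre_map !summxE mulr_sumr; apply: eq_bigr => j _.
rewrite !mxE -[in c ^+ k](card_ord k) -prodr_const -big_split /=.
by apply: eq_bigr => i _; rewrite !mxE.
Qed.

Lemma scale_pure_tensor (a : forall i : 'I_k, 'rV[K]_(tnth n i).+1) c :
  exists b, c *: pure_tensor a = pure_tensor b.
Proof.
pose i0 := Ordinal k_gt0.
exists (fun i => (if i == i0 then c else 1) *: a i).
apply/rowP => t; rewrite !mxE (bigD1 i0) //= [RHS](bigD1 i0) //= !mxE ?eqxx mulrA.
by congr (_ * _); apply: eq_bigr => i /negbTE ii0; rewrite mxE ii0 mul1r.
Qed.

(** The coefficients of a linear combination of pure tensors can be absorbed
    into one factor each. *)
Lemma secant_union_sum_pure v :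
  secant_union s (@segre K k n) v -> exists A, v = sum_pure A.
Proof.
move=> [_ [p [Xp vp]]].
have /fin_all_exists[A HA] (j : 'I_s) : exists a, coord p j v *: tnth p j = pure_tensor a.
  have [_ [a ->]] := Xp _ (mem_tnth j p); exact: scale_pure_tensor.
exists A; rewrite (coord_span vp) /sum_pure; apply: eq_bigr => j _.
by rewrite -HA (tnth_nth 0).
Qed.

Definition unit_pure : tensor_space K n := pure_tensor (fun i => \row_c (c == ord0)%:R).

Lemma unit_pure_neq0 : unit_pure != 0.
Proof.
apply/eqP => /rowP/(_ (enum_rank ([ffun=> ord0] : multi_index n))).
rewrite !mxE enum_rankK big1 => [/eqP|i _]; first by rewrite oner_eq0.
by rewrite mxE ffunE eqxx.
Qed.

(** A summand that is zero is no point of the Segre variety and is replaced by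
    an arbitrary point, taken with coefficient zero. *)
Lemma sum_pure_secant_union A :
  sum_pure A != 0 -> secant_union s (@segre K k n) (sum_pure A).
Proof.
move=> nz; split=> //.
pose q j : tensor_space K n := if pure_tensor (A j) == 0 then unit_pure else pure_tensor (A j).
exists [tuple q j | j < s]; split.
  move=> x /tnthP[j ->]; rewrite tnth_mktuple /q.
  by case: eqP => [_|/eqP ?]; split; rewrite ?unit_pure_neq0 //; eexists.
apply: rpred_sum => j _.
have := memv_span (mem_tnth j [tuple q j | j < s]); rewrite tnth_mktuple /q.
by case: eqP => // ->; rewrite mem0v.
Qed.

Lemma exists_sum_pure_neq0 t : exists A, sum_pure A 0 t != 0.
Proof.
pose j0 := Ordinal s_gt0.
exists (fun j i => \row_c ((j == j0) && (c == (enum_val t : multi_index n) i))%:R).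
rewrite summxE (bigD1 j0) //= big1 ?addr0.
  by rewrite mxE big1 ?oner_eq0 // => i _; rewrite mxE !eqxx.
move=> j jj0; rewrite mxE (bigD1 (Ordinal k_gt0)) //= mxE (negbTE jj0) /=.
by rewrite mul0r.
Qed.

Lemma segre_map_neq0 t : tnth segre_map t != 0.
Proof.
have [A] := exists_sum_pure_neq0 t; rewrite -sum_pure_param.
by apply: contraNneq => ->; rewrite meval0.
Qed.

Lemma multi_index_gt0 : (0 < N)%N.
Proof. by apply/card_gt0P; exists [ffun=> ord0]. Qed.

(** A sum of pure tensors is a point of the secant variety only where it is
    nonzero, so f(Phi) is first multiplied by a component of Phi. *)
Lemma vanishes_secant_kernel e f :
  f \is e.-homog -> vanishes_on (secant s (@segre K k n)) f -> f \in kernel segre_map.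
Proof.
move=> fe fZ; pose t0 := Ordinal multi_index_gt0.
suff /eqP : (f \mPo segre_map) * tnth segre_map t0 = 0.
  by rewrite mulf_eq0 (negbTE (segre_map_neq0 _)) orbF.
apply: (mpoly_eq0_infinite charK) => y; rewrite mevalM comp_mpoly_meval.
have [->|nz] := eqVneq (tnth segre_map t0).@[y] 0; first by rewrite mulr0.
have nzA : sum_pure (factors_of y) != 0.
  by apply: contraNneq nz; rewrite meval_segre_map => ->; rewrite mxE.
suff -> : f.@[fun t => (tnth segre_map t).@[y]] = 0 by rewrite mul0r.
under meval_eq => t do rewrite meval_segre_map.
apply: fZ; split=> // e' f' fe' fU; apply: fU; exact: sum_pure_secant_union.
Qed.

(** The kernel is generated by homogeneous elements, and those vanish on the
    secant variety. *)
Lemma kernel_sub_ideal (P : {pred {mpoly K[N]}}) f :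
  proj_prime P -> contains_ideal_of (secant s (@segre K k n)) P ->
  f \in kernel segre_map -> f \in P.
Proof.
move=> [[[P0 _ PD] _] _ _] cP fker.
have PA u v : u \in P -> v \in P -> u + v \in P.
  by move=> uP vP; rewrite -[u]mul1r PD.
rewrite (pihomog_partitionE (mf := mdeg) (leqnn (msize f))).
elim/big_ind: _ => // d _; apply: (cP d); first exact: pihomogP.
have t0 := Ordinal multi_index_gt0.
move=> v [v0 vZ]; apply: (vZ d); first exact: pihomogP.
move=> w /secant_union_sum_pure [A ->].
have hom c : f.@[fun t => c ^+ k * sum_pure A 0 t] = 0.
  have /(kernelP charK)/(_ (fun m => c * param_of A 0 m)) f0 := fker.
  by rewrite -[RHS]f0; apply: meval_eq => t; rewrite eval_homog_segre_map sum_pure_param.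
exact: (pihomog_vanish charK k_gt0 hom).
Qed.

(** It is enough that psi reaches the values of Phi off the hypersurface D = 0,
    because an identity between polynomials only has to hold there. *)
Theorem secant_dim_lt r (psi : N.-tuple {mpoly K[r]}) (D : {mpoly K[#|param|]}) :
  D != 0 ->
  (forall A : factors, D.@[param_of A 0] != 0 ->
     exists z, forall t, (tnth psi t).@[z] = sum_pure A 0 t) ->
  forall d, prime_chain (secant s (@segre K k n)) d -> (d < r)%N.
Proof.
move=> D0 dense d; apply: (@prime_chain_lt_vars _ _ _ _ psi) => P Pprime cP f f0.
apply: kernel_sub_ideal cP _ => //; rewrite inE.
suff /eqP : (f \mPo segre_map) * D = 0 by rewrite mulf_eq0 (negbTE D0) orbF.
apply: (mpoly_eq0_infinite charK) => y; rewrite mevalM comp_mpoly_meval.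
have [->|nz] := eqVneq D.@[y] 0; first by rewrite mulr0.
have yE : y =1 param_of (factors_of y) 0.
  move=> m; rewrite mxE -[in LHS](enum_valK m); case: (enum_val m) => j [i c].
  by rewrite mxE.
rewrite (meval_eq _ yE) in nz; have [z zE] := dense _ nz.
suff -> : f.@[fun t => (tnth segre_map t).@[y]] = 0 by rewrite mul0r.
transitivity (f \mPo psi).@[z]; last by rewrite f0 meval0.
by rewrite comp_mpoly_meval; apply: meval_eq => t; rewrite zE meval_segre_map.
Qed.

(** The derivative of a product of entries, one factor at a time; its values are
    the sums of tangent vectors at the points. *)
Lemma jacobian_segre_map y (b : 'rV[K]_#|param|) t :
  (b *m jacobian segre_map y) 0 t =
  \sum_j \sum_i b 0 (coordinate j ((enum_val t : multi_index n) i)) *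
     \prod_(l | l != i) y (coordinate j ((enum_val t : multi_index n) l)).
Proof.
rewrite mxE; set x := (enum_val t : multi_index n).
transitivity (\sum_m b 0 m * \sum_j \sum_i (coordinate j (x i) == m)%:R *
     \prod_(l | l != i) y (coordinate j (x l))).
  apply: eq_bigr => m _; congr (_ * _); rewrite mxE tnth_mktuple.
  rewrite (raddf_sum (mderiv m)) raddf_sum; apply: eq_bigr => j _.
  rewrite (derivation_prod _ (mderivM m)) ?index_enum_uniq // raddf_sum.
  apply: eq_bigr => i _; rewrite /= mevalM rmorph_prod /= mderiv_var mevalC.
  by congr (_ * _); apply: eq_bigr => l _; rewrite mevalXU.
under eq_bigr => m _ do rewrite mulr_sumr.
rewrite exchange_big; apply: eq_bigr => j _ /=.
under eq_bigr => m _ do rewrite mulr_sumr.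
rewrite exchange_big; apply: eq_bigr => i _ /=.
rewrite (bigD1 (coordinate j (x i))) //= eqxx mul1r [X in _ + X]big1 ?addr0 // => m.
by rewrite eq_sym => /negbTE ->; rewrite mul0r mulr0.
Qed.

Lemma prime_chain_secant0 : prime_chain (secant s (@segre K k n)) 0.
Proof.
exists (fun=> kernel segre_map); split=> [i|i j]; last by rewrite !ord1.
have [A At0] := exists_sum_pure_neq0 (Ordinal multi_index_gt0).
split; last exact: vanishes_secant_kernel.
apply: (proj_prime_kernel charK k_gt0 eval_homog_segre_map (y := param_of A 0)).
by rewrite sum_pure_param; exact: At0.
Qed.

(** By the Euler relation the differential of Phi at a maps a to a nonzero
    multiple of Phi(a), so the linear space of prime_chain_of_jacobian can be
    chosen through a. *)
Theorem secant_dim_ge r (A : factors) :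
  sum_pure A != 0 -> (r < \rank (jacobian segre_map (param_of A 0%R)))%N ->
  prime_chain (secant s (@segre K k n)) r.
Proof.
move=> nzA rJ.
have [t0 At0] : exists t, sum_pure A 0 t != 0.
  apply/existsP; apply: contraNT nzA; rewrite negb_exists => /forallP H.
  by apply/eqP/rowP => t; rewrite mxE; apply/eqP/negPn.
have [|L L0 Lfree] := exists_rows_through (u := param_of A) _ rJ.
  apply: contraNneq At0 => /rowP/(_ t0); rewrite jacobian_segre_map mxE.
  rewrite (eq_bigr (fun j => k%:R * pure_tensor (A j) 0 t0)) => [|j _].
    rewrite -mulr_sumr -summxE => /eqP; rewrite mulf_eq0 ((pcharf0P _).1 charK).
    by rewrite -leqn0 leqNgt k_gt0.
  rewrite mxE -[X in X%:R](card_ord k) mulr_natl -sumr_const.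
  apply: eq_bigr => i _; rewrite [RHS](bigD1 i) //= coordinateK.
  by congr (_ * _); apply: eq_bigr => l _; rewrite coordinateK.
apply: (prime_chain_of_jacobian charK (L := L) k_gt0 eval_homog_segre_map).
- exact: vanishes_secant_kernel.
- by rewrite L0.
by exists t0; rewrite L0 sum_pure_param.
Qed.

End Segre.

(** * Dimension bounds for the secant varieties *)

Section Dimension.
Variables (K : fieldType) (k : nat) (n : k.-tuple nat) (s : nat).
Hypothesis charK : [pchar K] =i pred0.
Hypotheses (k_gt0 : (0 < k)%N) (s_gt0 : (0 < s)%N).

Notation N := #|{: multi_index n}|.
Notation Z := (secant s (@segre K k n)).

Lemma card_multi_index : N = (\prod_(i < k) (tnth n i).+1)%N.
Proof.
rewrite card_dep_ffun foldrE big_map big_enum /=.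
by apply: eq_bigr => i _; rewrite card_ord.
Qed.

Lemma secant_dim_lt_ambient d : prime_chain Z d -> (d < N)%N.
Proof.
move: d; apply: (@secant_dim_lt K k n s charK k_gt0 N [tuple 'X_t | t < N] 1).
  exact: oner_neq0.
by move=> A _; exists (sum_pure A 0) => t; rewrite tnth_mktuple mevalXU.
Qed.

Let affine_param : finType := ('I_s * option {i : 'I_k & 'I_(tnth n i)})%type.

Let card_affine_param : #|affine_param| = (s * (\sum_(i < k) tnth n i).+1)%N.
Proof.
rewrite card_prod card_ord card_option card_tagged sumnE big_map big_enum /=.
by congr (_ * _.+1)%N; apply: eq_bigr => i _; rewrite card_ord.
Qed.

Let scalar_var (j : 'I_s) : 'I_#|affine_param| := enum_rank ((j, None) : affine_param).
Let affine_var (j : 'I_s) (i : 'I_k) (c : 'I_(tnth n i)) : 'I_#|affine_param| :=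
  enum_rank ((j, Some (Tagged (fun i => 'I_(tnth n i)) c)) : affine_param).

Let affine_map : N.-tuple {mpoly K[#|affine_param|]} :=
  [tuple \sum_j 'X_(scalar_var j) *
     \prod_i (if unlift ord0 ((enum_val t : multi_index n) i) is Some c
              then 'X_(affine_var j c) else 1) | t < N].

(** Each factor of a general pure tensor is scaled so that its first entry
    is one, and the scalars are collected in one variable per summand. *)
Lemma secant_dim_lt_params d : prime_chain Z d -> (d < s * (\sum_(i < k) tnth n i).+1)%N.
Proof.
rewrite -card_affine_param; move: d.
apply: (secant_dim_lt charK k_gt0 (psi := affine_map)
  (D := \prod_j \prod_i 'X_(coordinate (j : 'I_s) (ord0 : 'I_(tnth n i).+1)))).
  apply/prodf_neq0 => j _; apply/prodf_neq0 => i _.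
  by rewrite -msize_poly_eq0 msizeX.
move=> A; rewrite rmorph_prod => /prodf_neq0 A0.
have {}A0 j i : A j i 0 ord0 != 0.
  have := A0 j isT; rewrite rmorph_prod => /prodf_neq0 /(_ i isT) /=.
  by rewrite mevalXU coordinateK.
exists (fun m => match (enum_val m : affine_param) with
   | (j, None) => \prod_i A j i 0 ord0
   | (j, Some x) => A j (tag x) 0 (lift ord0 (tagged x)) / A j (tag x) 0 ord0
   end) => t.
rewrite tnth_mktuple raddf_sum summxE; apply: eq_bigr => j _ /=.
rewrite mevalM mevalXU enum_rankK rmorph_prod mxE -big_split /=.
apply: eq_bigr => i _; case: unliftP => [c ->|->]; last by rewrite meval1 mulr1.
by rewrite mevalXU enum_rankK /= mulrCA divff ?mulr1.
Qed.

(** The row space of the Jacobian matrix is the sum of the affine tangent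
    spaces at the points, and bounds the dimension from below; the two general
    upper bounds meet it. *)
Theorem nondefective_of_rank (A : factors K n s) :
  sum_pure A != 0 ->
  (minn (\prod_(i < k) (tnth n i).+1) (s * (\sum_(i < k) tnth n i).+1) <=
     \rank (jacobian (segre_map K n s) (param_of A 0%R)))%N ->
  segre_secant_nondefective K n s.
Proof.
move=> nzA; set P := (\prod_(i < k) _)%N; set Q := (s * _)%N => rJ.
have EP : segre_secant_expdim n s = (minn P Q).-1.
  rewrite /segre_secant_expdim -/P -mulnSr -/Q !subn1.
  by move: P Q {rJ} => P Q; lia.
have PQ_gt0 : (0 < minn P Q)%N.
  by rewrite leq_min /P -card_multi_index multi_index_gt0 muln_gt0 s_gt0.
rewrite /segre_secant_nondefective EP; split.
  by apply: (secant_dim_ge charK k_gt0 s_gt0 nzA); rewrite prednK.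
move=> d dZ; rewrite -ltnS prednK // leq_min /P -card_multi_index.
by rewrite secant_dim_lt_ambient // secant_dim_lt_params.
Qed.

(** For large n_l, tensors are viewed as matrices with rows indexed by the
    multi-indices of the other factors (represented by the slice where the l-th
    index is zero) and columns by the l-th index.  A sum of s pure tensors has
    rank at most s; generically s fixed pivot rows are independent, and the
    matrix is determined by them and by the coefficients that express the other
    rows. *)
Section Unbalanced.
Variable l : 'I_k.

Let W_size := (\prod_(i < k | i != l) (tnth n i).+1)%N.
Let slice : {set multi_index n} := [set x : multi_index n | x l == ord0].

Let card_slice : #|slice| = W_size.
Proof.
pose F (i : 'I_k) : pred 'I_(tnth n i).+1 := if i == l then pred1 ord0 else predT.
have E : slice =i (family F : simpl_pred (multi_index n)).
  move=> x; rewrite inE; apply/eqP/familyP => [xl i|/(_ l)]; rewrite /F.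
    by case: eqP => // ->; rewrite xl inE.
  by rewrite eqxx inE => /eqP.
rewrite (eq_card E) card_family foldrE big_map big_enum /= [LHS](bigD1 l) //= /F eqxx card1 mul1n.
by apply: eq_bigr => i /negbTE ->; rewrite card_ord.
Qed.

Hypothesis s_le : (s <= W_size)%N.

Let pivot (i : 'I_s) : multi_index n :=
  enum_val (widen_ord (leq_trans s_le (eq_leq (esym card_slice))) i).

Let pivot_inj : injective pivot.
Proof. by move=> i j /enum_val_inj /(congr1 val) /= /val_inj. Qed.

Let pivot_slice i : pivot i \in slice.
Proof. exact: enum_valP. Qed.

Let free := slice :\: [set pivot i | i : 'I_s].

Let card_free : #|free| = (W_size - s)%N.
Proof.
rewrite cardsD (setIidPr _) ?card_imset ?card_ord ?card_slice //.
by apply/subsetP => _ /imsetP[i _ ->].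
Qed.

Let rank_param : finType :=
  ('I_s * {x | x \in free} + 'I_s * 'I_(tnth n l).+1)%type.

Let card_rank_param : #|rank_param| = (s * (W_size - s) + s * (tnth n l).+1)%N.
Proof. by rewrite card_sum !card_prod !card_ord card_sig card_free. Qed.

Let base (t : multi_index n) : multi_index n := [ffun i => if i == l then ord0 else t i].

Let vec_var i c : {mpoly K[#|rank_param|]} := 'X_(enum_rank (inr (i, c) : rank_param)).
Let coef_var i x : {mpoly K[#|rank_param|]} :=
  if insub x is Some x' then 'X_(enum_rank (inl (i, x') : rank_param)) else 0.

Let rank_map : N.-tuple {mpoly K[#|rank_param|]} :=
  [tuple (let t := (enum_val u : multi_index n) in
      if [pick i | pivot i == base t] is Some i then vec_var i (t l)
      else \sum_i coef_var i (base t) * vec_var i (t l)) | u < N].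

Let weight (A : factors K n s) j (x : multi_index n) := \prod_(i | i != l) A j i 0 (x i).
Let pivot_mx (A : factors K n s) : 'M[K]_s := \matrix_(j, i) weight A j (pivot i).
Let pivot_det : {mpoly K[#|param n s|]} :=
  \det (\matrix_(j, i) \prod_(i' | i' != l) 'X_(coordinate j (pivot i i'))).

Let meval_pivot_det A : pivot_det.@[param_of A 0] = \det (pivot_mx A).
Proof.
rewrite -det_map_mx; congr (\det _); apply/matrixP => j i; rewrite !mxE rmorph_prod.
by apply: eq_bigr => i' _; rewrite /= mevalXU coordinateK.
Qed.

Let pivot_det_neq0 : pivot_det != 0.
Proof.
(* At the coordinate vectors given by the pivots the minor is the identity. *)
pose A : factors K n s := fun j i => \row_c (c == pivot j i)%:R.
have := meval_pivot_det A.
have -> : pivot_mx A = 1%:M.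
  apply/matrixP => j i; rewrite !mxE /weight.
  have [->|ji] := eqVneq j i; first by apply: big1 => i' _; rewrite mxE eqxx.
  have [i' i'l pi'] : exists2 i', i' != l & pivot i i' != pivot j i'.
    apply/exists_inP; apply: contraNT ji; rewrite negb_exists_in => /forall_inP H.
    apply/eqP/pivot_inj/ffunP => i'; have [->|/H] := eqVneq i' l; last by rewrite negbK => /eqP.
    by have := (pivot_slice i, pivot_slice j); rewrite !inE => -[/eqP-> /eqP->].
  by rewrite (bigD1 i') //= mxE (negbTE pi') mul0r.
by rewrite det1; apply: contra_eqN => /eqP->; rewrite meval0 eq_sym oner_eq0.
Qed.

Lemma secant_dim_lt_unbalanced d :
  prime_chain Z d -> (d < s * (W_size - s) + s * (tnth n l).+1)%N.
Proof.
rewrite -card_rank_param; move: d.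
apply: (secant_dim_lt charK k_gt0 (psi := rank_map) pivot_det_neq0) => A.
rewrite meval_pivot_det -unitfE -unitmxE => Uunit; set U := pivot_mx A in Uunit.
exists (fun m => match (enum_val m : rank_param) with
   | inl (i, x) => \sum_j (invmx U) i j * weight A j (val x)
   | inr (i, c) => \sum_j U j i * A j l 0 c
   end) => u.
rewrite tnth_mktuple /=; set t := (enum_val u : multi_index n).
have -> : sum_pure A 0 u = \sum_j weight A j (base t) * A j l 0 (t l).
  rewrite summxE; apply: eq_bigr => j _; rewrite mxE (bigD1 l) //= mulrC; congr (_ * _).
  by apply: eq_bigr => i /negbTE il; rewrite ffunE il.
case: pickP => [i /eqP <-|nopivot].
  by rewrite mevalXU enum_rankK; apply: eq_bigr => j _; rewrite mxE.
have base_free : base t \in free.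
  rewrite !inE ffunE eqxx andbT; apply/imsetP => -[i _ /esym/eqP].
  by rewrite nopivot.
rewrite raddf_sum /=.
pose w := \col_j weight A j (base t); pose v := \row_j A j l 0 (t l).
transitivity ((v *m U *m (invmx U *m w)) 0 0).
  rewrite mxE; apply: eq_bigr => i _; rewrite mevalM /coef_var insubT !mevalXU !enum_rankK.
  rewrite /= mulrC !mxE; congr (_ * _); apply: eq_bigr => j _; rewrite !mxE //.
  by rewrite mulrC.
rewrite mulmxA mulmxK // mxE; apply: eq_bigr => j _.
by rewrite !mxE mulrC.
Qed.

End Unbalanced.

(** With P the number of rows, matrices of rank at most s have dimension
    s (P - s) + s (n_l + 1); under the hypotheses this is less than both terms of
    the expected dimension. *)
Theorem defective_of_unbalanced (l : 'I_k) :
  let rest := (\prod_(i < k | i != l) (tnth n i).+1)%N in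
  (s < rest)%N -> (s <= tnth n l)%N -> (rest < s + \sum_(i < k | i != l) tnth n i)%N ->
  segre_secant_defective K n s.
Proof.
move=> rest sW sl Ws.
have [d dZ dmax] := exists_max (prime_chain_secant0 n charK k_gt0 s_gt0)
  (secant_dim_lt_unbalanced (ltnW sW)).
exists d; first by split.
apply: leq_trans (secant_dim_lt_unbalanced (ltnW sW) dZ) _.
rewrite /segre_secant_expdim.
have -> : (\prod_(i < k) (tnth n i).+1 = (tnth n l).+1 * rest)%N by rewrite (bigD1 l).
have -> : (\sum_(i < k) tnth n i = tnth n l + \sum_(i < k | i != l) tnth n i)%N.
  by rewrite (bigD1 l).
rewrite -/rest; move: (\sum_(i < k | _) _)%N (tnth n l) rest sW sl Ws => S a W sW sl Ws.
rewrite -mulnDr leq_min; apply/andP; split.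
  rewrite -ltnS subn1 prednK; first by nia.
  nia.
nia.
Qed.

End Dimension.

(** * Tangent vectors in coordinates *)

(** The number of factors and the sizes of the factors vary in the inductions
    below, so tensors are functions of positions x : nat -> nat, read only inside
    a box, and the entries of all factors are functions on nat: a j i c is the
    c-th entry of the i-th factor of the j-th point. *)
Section Tangents.
Variables (K : fieldType) (s : nat).
Implicit Types (a b : nat -> nat -> nat -> K) (n x : nat -> nat) (k : nat).

Definition in_box k n x := forall i, (i < k)%N -> (x i <= n i)%N.

Definition tangent k (a b : nat -> nat -> K) x : K :=
  \sum_(0 <= i < k) b i (x i) * \prod_(0 <= l < k | l != i) a l (x l).

(** Independence of the tangent spaces as subspaces, whatever their
    dimensions: if the sum of a tangent vector from each is zero, all are zero.
    The normalization of the first entries makes every pure tensor nonzero, at a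
    place that stays in every box. *)
Definition tangents_independent k n a :=
  (forall j i, a j i 0%N = 1) /\
  forall b, (forall x, in_box k n x -> \sum_(0 <= j < s) tangent k (a j) (b j) x = 0) ->
  forall x, in_box k n x -> forall j, (j < s)%N -> tangent k (a j) (b j) x = 0.

(** The target is a function of the list of the first k positions, because a
    tangent vector cannot depend on more. *)
Definition tangents_span k n a :=
  (forall j i, a j i 0%N = 1) /\
  forall t : seq nat -> K, exists b, forall x, in_box k n x ->
    \sum_(0 <= j < s) tangent k (a j) (b j) x = t (mkseq x k).

Lemma tangents_span_sub k n n' a :
  in_box k n n' -> tangents_span k n a -> tangents_span k n' a.
Proof.
move=> n'n [a0 spa]; split=> // t; have [b bt] := spa t.
by exists b => x xn'; apply: bt => i ik; apply: leq_trans (xn' i ik) (n'n i ik).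
Qed.

Lemma eq_tangent k (a a' b b' : nat -> nat -> K) x x' :
  (forall i, (i < k)%N -> a i (x i) = a' i (x' i)) ->
  (forall i, (i < k)%N -> b i (x i) = b' i (x' i)) ->
  tangent k a b x = tangent k a' b' x'.
Proof.
move=> Ea Eb; apply: eq_big_nat => i /andP[_ ik]; rewrite Eb //; congr (_ * _).
rewrite big_nat_cond [RHS]big_nat_cond; apply: eq_bigr => l /andP[/andP[_ lk] _].
exact: Ea.
Qed.

Lemma tangent_single k (a b : nat -> nat -> K) x i0 :
  (i0 < k)%N ->
  (forall i, (i < k)%N -> i != i0 ->
     b i (x i) * \prod_(0 <= l < k | l != i) a l (x l) = 0) ->
  tangent k a b x = b i0 (x i0) * \prod_(0 <= l < k | l != i0) a l (x l).
Proof.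
move=> i0k z; rewrite /tangent (bigD1_seq i0) ?mem_index_iota ?iota_uniq //=.
rewrite [X in _ + X]big_nat_cond [X in _ + X]big1 ?addr0 // => i /andP[/andP[_ ik] ii0]; exact: z.
Qed.

Lemma prod_zero_at k (a : nat -> nat -> K) x i i0 :
  (i0 < k)%N -> i != i0 -> a i0 (x i0) = 0 ->
  \prod_(0 <= l < k | l != i) a l (x l) = 0.
Proof.
move=> i0k ii0 az; rewrite -big_filter (bigD1_seq i0) /=.
- by rewrite az mul0r.
- by rewrite mem_filter eq_sym ii0 mem_index_iota.
- by rewrite filter_uniq // iota_uniq.
Qed.

(** The points keep their entries, and the new entries are zero.  At a
    position with exactly one coordinate i0 outside the old box, the j-th tangent
    vector is an entry beta_j of the direction times the pure tensor w_j of the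
    other factors.  The tangent spaces contain the w_j tensored with any fixed
    vector, so their independence makes the w_j independent, and beta_j = 0. *)
Lemma tangents_independent_raise k n n' a :
  in_box k n' n -> tangents_independent k n a ->
  tangents_independent k n' (fun j i c => if (c <= n i)%N then a j i c else 0).
Proof.
move=> nn' [a0 ind]; pose a' j i c := if (c <= n i)%N then a j i c else 0.
rewrite -/a'; split=> [j i|b H]; first by rewrite /a' leq0n.
have a'E x : in_box k n x -> forall j i, (i < k)%N -> a' j i (x i) = a j i (x i).
  by move=> xn j i ik; rewrite /a' xn.
have Hn x : in_box k n x -> forall j, (j < s)%N -> tangent k (a j) (b j) x = 0.
  apply: ind => {}x xn; rewrite -[RHS](H x) => [|i ik]; last exact: leq_trans (xn i ik) (nn' i ik).
  by apply: eq_bigr => j _; apply: eq_tangent => // i ik; rewrite a'E.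
have H1 i0 c j : (i0 < k)%N -> (n i0 < c <= n' i0)%N -> (j < s)%N -> b j i0 c = 0.
  move=> i0k /andP[nc cn'] js.
  (* The direction that sums up the w_j tensored with the first basis vector. *)
  pose b' j i e := if (i == i0) && (e == 0)%N then b j i0 c else 0.
  have b'E j' x : tangent k (a j') (b' j') x =
      b' j' i0 (x i0) * \prod_(0 <= l < k | l != i0) a j' l (x l).
    by apply: tangent_single => // i _ /negbTE ii0; rewrite /b' ii0 mul0r.
  have : tangent k (a j) (b' j) (fun=> 0%N) = 0.
    apply: ind => // x xn.
    have [x0|x0] := eqVneq (x i0) 0%N; last first.
      by rewrite big1 // => j' _; rewrite b'E /b' (negbTE x0) andbF mul0r.
    pose y i := if i == i0 then c else x i.
    rewrite -[RHS](H y) => [|i ik]; last first.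
      by rewrite /y; case: eqP => [->|_] //; apply: leq_trans (xn i ik) (nn' i ik).
    apply: eq_bigr => j' _; rewrite b'E /b' eqxx x0 /=.
    rewrite (@tangent_single _ _ _ _ i0) // => [|i ik ii0].
      rewrite /y eqxx; congr (_ * _).
      rewrite big_nat_cond [RHS]big_nat_cond; apply: eq_bigr => l /andP[/andP[_ lk] /negbTE li0].
      by rewrite li0 /a' xn.
    by rewrite (@prod_zero_at _ _ _ _ i0) ?mulr0 // /y eqxx /a' leqNgt nc.
  by rewrite b'E /b' !eqxx big1 // mulr1.
move=> x xn' j js.
have [/hasP[i0 i0k nx]|xn] := boolP (has (fun i => (n i < x i)%N) (iota 0 k)).
  rewrite mem_iota /= in i0k.
  rewrite (@tangent_single _ _ _ _ i0) // => [|i ik ii0].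
    by rewrite H1 ?mul0r // nx xn'.
  by rewrite (@prod_zero_at _ _ _ _ i0) ?mulr0 // /a' leqNgt nx.
have {}xn : in_box k n x.
  by move=> i ik; rewrite leqNgt; apply: contra xn => nx; apply/hasP; exists i; rewrite ?mem_iota.
rewrite -[RHS](Hn x xn j js); apply: eq_tangent => // i ik; exact: a'E.
Qed.

(** A factor of dimension one only rescales: its directions can be moved to
    the first factor. *)
Lemma tangents_independent_pad k n a : n k = 0%N -> (0 < k)%N ->
  tangents_independent k n a -> tangents_independent k.+1 n a.
Proof.
move=> nk0 k0 [a0 ind]; split=> // b H x xn j js.
pose b' j i c := b j i c + (if i == 0%N then b j k 0%N * a j 0%N c else 0).
have E j' y : in_box k.+1 n y -> tangent k.+1 (a j') (b j') y = tangent k (a j') (b' j') y.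
  move=> yn; have yk : y k = 0%N by apply/eqP; rewrite -leqn0 -nk0 yn.
  have k0' : 0%N \in index_iota 0 k by rewrite mem_index_iota.
  rewrite /tangent big_nat_recr //= yk.
  rewrite [X in _ + _ * X](_ : _ = \prod_(0 <= l < k) a j' l (y l)); last first.
    rewrite big_mkcond big_nat_recr //= eqxx mulr1; apply: eq_big_nat => l /andP[_ lk].
    by rewrite ltn_eqF.
  rewrite /b'; under [RHS]eq_bigr => i _ do rewrite mulrDl.
  rewrite big_split /=; congr (_ + _).
    apply: eq_big_nat => i /andP[_ ik]; congr (_ * _).
    by rewrite big_mkcond big_nat_recr //= -big_mkcond /= eq_sym ltn_eqF // yk a0 mulr1.
  rewrite [RHS](bigD1_seq 0%N) ?iota_uniq //= [X in _ = _ + X]big1 ?addr0 => [|i /negbTE->].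
    by rewrite -mulrA; congr (_ * _); rewrite (bigD1_seq 0%N) ?iota_uniq.
  by rewrite mul0r.
rewrite E //; apply: ind => [y yn|i ik|//]; last by apply: xn; apply: leqW.
pose z i := if i == k then 0%N else y i.
have zn : in_box k.+1 n z.
  by move=> i; rewrite ltnS leq_eqVlt /z; case: eqP => // _ /= ik; apply: yn.
rewrite -[RHS](H z zn); apply: eq_bigr => j' _; rewrite E //.
by apply: eq_tangent => i ik; rewrite /z ltn_eqF.
Qed.

End Tangents.

(** * From six tangent spaces to the dimension *)

Section Bridge.
Variables (K : fieldType) (k : nat) (n : k.-tuple nat) (s : nat).
Hypothesis charK : [pchar K] =i pred0.
Hypotheses (k_gt0 : (0 < k)%N) (s_gt0 : (0 < s)%N).
Variable a : nat -> nat -> nat -> K.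
Hypothesis a0 : forall j i, a j i 0%N = 1.

Notation nn := (nth 0%N n).
Let A : factors K n s := fun j i => \row_c a j i c.
Let J := jacobian (segre_map K n s) (param_of A 0).

Let index_fun (t : multi_index n) (i : nat) : nat := if insub i is Some i' then t i' else 0%N.

Let index_funE t (i : 'I_k) : index_fun t i = t i.
Proof. by rewrite /index_fun valK. Qed.

Let index_fun_box t : in_box k nn (index_fun t).
Proof.
move=> i ik; rewrite -[i]/(nat_of_ord (Ordinal ik)) index_funE -tnth_nth.
by rewrite -ltnS ltn_ord.
Qed.

Let multi_index_of (x : nat -> nat) : multi_index n := [ffun i : 'I_k => inord (x i)].

Let multi_index_ofE x (i : 'I_k) : in_box k nn x -> index_fun (multi_index_of x) i = x i.
Proof. by move=> xn; rewrite index_funE ffunE inordK // ltnS (tnth_nth 0%N) xn. Qed.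

Let untyped (b : 'rV[K]_#|param n s|) (j i c : nat) : K :=
  if insub j is Some j' then
    if insub i is Some i' then b 0 (coordinate (j' : 'I_s) (inord c : 'I_(tnth n i').+1))
    else 0
  else 0.

Let untypedE b (j : 'I_s) (i : 'I_k) (c : 'I_(tnth n i).+1) :
  untyped b j i c = b 0 (coordinate j c).
Proof. by rewrite /untyped !valK inord_val. Qed.

Let jacobian_tangent b t :
  (b *m J) 0 t = \sum_(0 <= j < s) tangent k (a j) (untyped b j) (index_fun (enum_val t)).
Proof.
rewrite jacobian_segre_map big_mkord; apply: eq_bigr => j _.
rewrite /tangent big_mkord; apply: eq_bigr => i _.
rewrite index_funE untypedE; congr (_ * _).
rewrite big_mkord; apply: eq_bigr => l _.
by rewrite index_funE coordinateK mxE.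
Qed.

Let sum_pure_neq0 : sum_pure A != 0.
Proof.
apply/eqP => /rowP/(_ (enum_rank (multi_index_of (fun=> 0%N)))).
rewrite summxE mxE (eq_bigr (fun=> 1)) => [|j _].
  by move/eqP; rewrite sumr_const card_ord ((pcharf0P _).1 charK) -leqn0 leqNgt s_gt0.
rewrite mxE enum_rankK big1 // => i _.
by rewrite mxE ffunE inordK.
Qed.

(** The preimages of the basis tensors are the rows of a left inverse of the
    Jacobian matrix. *)
Lemma nondefective_of_tangents_span :
  tangents_span s k nn a -> segre_secant_nondefective K n s.
Proof.
move=> [_ spa]; apply: (nondefective_of_rank charK k_gt0 s_gt0 sum_pure_neq0).
suff /eqP Jfull : row_full J by rewrite -/J Jfull -card_multi_index geq_minl.
have H (t0 : 'I_#|{: multi_index n}|) : exists b, forall x, in_box k nn x ->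
    \sum_(0 <= j < s) tangent k (a j) (b j) x = (multi_index_of x == enum_val t0)%:R.
  have [b Hb] := spa (fun y => (multi_index_of (nth 0%N y) == enum_val t0)%:R).
  exists b => x xn; rewrite Hb //; congr ((_ == _)%:R); apply/ffunP => i.
  by rewrite !ffunE nth_mkseq.
have [B HB] := fin_all_exists H.
apply/row_fullP; exists (\matrix_t param_of (fun j i => \row_c B t j i c : 'rV_(tnth n i).+1)).
apply/row_matrixP => t; rewrite row_mul rowK; apply/rowP => u.
rewrite jacobian_tangent !mxE -(inj_eq enum_val_inj) eq_sym.
have {2}-> : enum_val u = multi_index_of (index_fun (enum_val u)).
  by apply/ffunP => i; rewrite ffunE index_funE inord_val.
rewrite -HB //; apply: eq_big_nat => j /andP[_ js]; apply: eq_tangent => // i ik.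
rewrite -[j]/(nat_of_ord (Ordinal js)) -[i]/(nat_of_ord (Ordinal ik)).
by rewrite index_funE untypedE coordinateK mxE.
Qed.

Let slice_param : finType := ('I_s * option {i : 'I_k & 'I_(tnth n i)})%type.
Let i0 : 'I_k := Ordinal k_gt0.
Let slice_coordinate (m : 'I_#|slice_param|) : 'I_#|param n s| :=
  match (enum_val m : slice_param) with
  | (j, None) => coordinate j (ord0 : 'I_(tnth n i0).+1)
  | (j, Some x) => coordinate j (lift ord0 (tagged x) : 'I_(tnth n (tag x)).+1)
  end.

Let slice_back (p : param n s) : slice_param :=
  (p.1, omap (Tagged (fun i => 'I_(tnth n i))) (unlift ord0 (tagged p.2))).

Let slice_coordinateK m : slice_back (enum_val (slice_coordinate m)) = enum_val m.
Proof.
rewrite /slice_coordinate; case: (enum_val m) => j [[i c]|]; rewrite enum_rankK.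
  by rewrite /slice_back /= liftK.
by rewrite /slice_back /= unlift_none.
Qed.

Let slice_coordinate_inj : injective slice_coordinate.
Proof.
by move=> m m' E; apply: enum_val_inj; rewrite -!slice_coordinateK E.
Qed.

(** The directions whose zeroth entry vanishes in all factors but the first
    form a complement of those rescalings of the factors that cancel each
    other.  There a zero tangent vector forces a zero direction: evaluate it at the positions with at most
    one nonzero coordinate.  So the Jacobian matrix has as many independent
    rows as there are slice parameters. *)
Lemma nondefective_of_tangents_independent :
  tangents_independent s k nn a -> segre_secant_nondefective K n s.
Proof.
move=> [_ ind]; apply: (nondefective_of_rank charK k_gt0 s_gt0 sum_pure_neq0).
suff Jfree : row_free (rowsub slice_coordinate J).
  apply: leq_trans (geq_minr _ _) _.
  have := mxrankS (rowsub_sub slice_coordinate J); rewrite (eqP Jfree).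
  rewrite card_prod card_ord card_option card_tagged sumnE big_map big_enum /=.
  by under eq_bigr do rewrite card_ord.
rewrite -kermx_eq0; apply/rowV0P => z /sub_kermxP.
rewrite rowsubE mulmxA; set b := z *m _ => bJ.
have bE m : b 0 (slice_coordinate m) = z 0 m.
  rewrite mxE (bigD1 m) //= big1 => [|m' m'm].
    by rewrite !mxE eqxx mulr1 addr0.
  by rewrite !mxE (inj_eq slice_coordinate_inj) (negbTE m'm) mulr0.
have b0 p : (forall m, slice_coordinate m != p) -> b 0 p = 0.
  by move=> np; rewrite mxE big1 // => m _; rewrite !mxE (negbTE (np m)) mulr0.
have tan0 (j : 'I_s) x : in_box k nn x -> tangent k (a j) (untyped b j) x = 0.
  move=> xn; apply: ind => // {}x {}xn.
  have := jacobian_tangent b (enum_rank (multi_index_of x)).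
  rewrite bJ mxE enum_rankK => E0; rewrite [RHS]E0.
  apply: eq_bigr => j' _; apply: eq_tangent => i ik.
    by rewrite -[i]/(nat_of_ord (Ordinal ik)) multi_index_ofE.
  by rewrite -[i]/(nat_of_ord (Ordinal ik)) multi_index_ofE.
have bslice (j : 'I_s) (i : 'I_k) : i != i0 -> b 0 (coordinate j (ord0 : 'I_(tnth n i).+1)) = 0.
  move=> ii0; apply: b0 => m; apply: contraNneq ii0 => E.
  have := slice_coordinateK m; rewrite E enum_rankK /slice_back /= unlift_none /=.
  move: E; rewrite /slice_coordinate; case: (enum_val m) => j' [x|] // E [jj'].
  by have /(congr1 (fun p : param n s => tag p.2)) := enum_rank_inj E => /= ->.
have z_scalar (j : 'I_s) : b 0 (coordinate j (ord0 : 'I_(tnth n i0).+1)) = 0.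
  rewrite -[RHS](tan0 j (fun=> 0%N)) //.
  rewrite (tangent_single (i0 := i0)) // => [|i ik ii0].
    rewrite big1 ?mulr1 => [|i _]; last exact: a0.
    by rewrite -[0%N]/(nat_of_ord (ord0 : 'I_(tnth n i0).+1)) untypedE.
  rewrite -[i]/(nat_of_ord (Ordinal ik)).
  rewrite -[X in untyped _ _ _ X]/(nat_of_ord (ord0 : 'I_(tnth n (Ordinal ik)).+1)).
  by rewrite untypedE bslice ?mul0r.
have z_affine (j : 'I_s) (i : 'I_k) (c : 'I_(tnth n i)) : b 0 (coordinate j (lift ord0 c)) = 0.
  pose x (l : nat) := if l == i :> nat then (lift ord0 c : nat) else 0%N.
  rewrite -[RHS](tan0 j x) => [|l lk]; last first.
    by rewrite /x; case: eqP => // ->; rewrite -tnth_nth -ltnS ltn_ord.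
  rewrite (tangent_single (i0 := i)) // => [|l lk li].
    rewrite big1 ?mulr1 => [|l /negbTE li]; last by rewrite /x li a0.
    by rewrite /x eqxx untypedE.
  rewrite /x (negbTE li) -[l]/(nat_of_ord (Ordinal lk)).
  rewrite -[X in untyped _ _ _ X]/(nat_of_ord (ord0 : 'I_(tnth n (Ordinal lk)).+1)) untypedE.
  have [->|li0] := eqVneq (Ordinal lk) i0; first by rewrite z_scalar mul0r.
  by rewrite bslice ?mul0r.
apply/rowP => m; rewrite [RHS]mxE -bE /slice_coordinate.
by case: (enum_val m) => j [[i c]|]; [apply: z_affine|apply: z_scalar].
Qed.

End Bridge.

(** * Tangent spaces at explicit points *)

(** One direction per dimension of the tangent space: the zeroth entry is
    kept in the first factor only, as the tangent vectors along the rescalings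
    of the factors coincide. *)
Definition directions (s : nat) (ns : seq nat) : seq (nat * nat * nat) :=
  [seq (j, ic.1, ic.2) | j <- iota 0 s,
     ic <- [seq (i, c) | i <- iota 0 (size ns), c <- iota (0 < i) (nth 0%N ns i + (i == 0%N))]].

Definition positions (ns : seq nat) := box (map succn ns).

Section Matrix.
Variables (R : comNzRingType) (s : nat) (ns : seq nat) (a : nat -> nat -> nat -> R).

Definition entry (d : nat * nat * nat) (x : nat -> nat) : R :=
  let: (j, i, c) := d in
  (x i == c)%:R * \prod_(0 <= l < size ns | l != i) a j l (x l).

Definition tangent_mx : 'M[R]_(size (directions s ns), size (positions ns)) :=
  \matrix_(d, x) entry (nth (0, 0, 0)%N (directions s ns) d) (nth 0%N (nth [::] (positions ns) x)).

End Matrix.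

Section Base.
Variables (K : fieldType) (s : nat) (ns : seq nat) (a : nat -> nat -> nat -> K).
Notation k := (size ns).
Notation nn := (nth 0%N ns).
Hypothesis a0 : forall j i, a j i 0%N = 1.
Hypothesis k_gt0 : (0 < k)%N.

Lemma directions_uniq : uniq (directions s ns).
Proof.
apply: allpairs_uniq; first exact: iota_uniq.
  apply: allpairs_uniq_dep; [exact: iota_uniq|by move=> i _; exact: iota_uniq|].
  by move=> [i c] [i' c'] _ _ /= [-> ->].
by move=> [j [i c]] [j' [i' c']] _ _ /= [-> -> ->].
Qed.

Lemma mem_directions j i c : (j, i, c) \in directions s ns =
  [&& (j < s)%N, (i < k)%N, (c <= nn i)%N & (i == 0%N) || (0 < c)%N].
Proof.
apply/allpairsP/and4P => [[[j' [i' c']] /= [js ic [-> -> ->]]]|[js ik cn ic]].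
  case/allpairsPdep: ic => i'' [c'' [ik cr [-> ->]]].
  rewrite !mem_iota /= in js ik cr; split=> //.
    by move: cr; case: (i'') => [|?] /=; lia.
  by move: cr; case: (i'') => [|?] /=; lia.
exists (j, (i, c)); split; rewrite ?mem_iota //=.
apply/allpairsPdep; exists i, c; split; rewrite ?mem_iota //=.
by case: (i) cn ic => [|?] /=; lia.
Qed.

Lemma positionsP x : reflect (size x = k /\ in_box k nn (nth 0%N x)) (x \in positions ns).
Proof.
rewrite /positions mem_box size_map.
have -> : (size x == k) && all2 ltn x (map succn ns) =
          (size x == k) && all (fun i => nth 0%N x i <= nn i)%N (iota 0 k).
  elim: (ns) x => [|m ms IH] [|c x] //=; rewrite !eqSS andbCA IH -andbCA; congr (_ && (_ && _)).
  by rewrite -[1%N]addn0 iotaDl all_map.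
apply: (iffP andP) => [[/eqP-> /allP H]|[-> H]]; split=> //.
  by move=> i ik; apply: H; rewrite mem_iota.
by apply/allP => i; rewrite mem_iota => /H.
Qed.

Lemma sum_directions (b : nat -> nat -> nat -> K) x : in_box k nn x ->
  (forall j i, (0 < i < k)%N -> b j i 0%N = 0) ->
  \sum_(d <- directions s ns) b d.1.1 d.1.2 d.2 * entry ns a d x =
  \sum_(0 <= j < s) tangent k (a j) (b j) x.
Proof.
move=> xn b0; rewrite big_flatten big_map /index_iota subn0; apply: eq_bigr => j _.
rewrite big_map big_flatten big_map /tangent /index_iota subn0.
rewrite big_seq [RHS]big_seq; apply: eq_bigr => i; rewrite mem_iota /= => ik.
rewrite big_map /=.
have [xi|xi] := boolP (x i \in iota (0 < i) (nn i + (i == 0%N))).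
  rewrite (bigD1_seq (x i)) ?iota_uniq //= eqxx mul1r ?subn0 [X in _ + X]big1 ?addr0 => [|c].
    by rewrite /index_iota subn0.
  by rewrite eq_sym => /negbTE ->; rewrite mul0r mulr0.
have [i0 xi0] : (0 < i)%N /\ x i = 0%N.
  by move: xi (xn i ik); rewrite mem_iota; case: (i) => [|?] /=; lia.
rewrite big_seq big1 => [|c cr]; first by rewrite xi0 b0 ?mul0r ?i0.
case: eqP => [xc|_]; last by rewrite mul0r mulr0.
by rewrite xc cr in xi.
Qed.

(** Adding to a direction multiples of the factors themselves, with
    coefficients that sum to zero, does not change the tangent vector; so every
    direction can be replaced by a combination of the listed ones. *)
Lemma tangents_independent_row_free :
  row_free (tangent_mx s ns a) -> tangents_independent s k nn a.
Proof.
move=> Mfree; split=> // b Hb x xn j js.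
(* b' kills the zeroth entries beyond the first factor, and compensates there. *)
pose b' j i c := b j i c - (i != 0%N)%:R * b j i 0%N * a j i c
  + (i == 0%N)%:R * (\sum_(0 <= i' < k | i' != 0%N) b j i' 0%N) * a j i c.
have b'E j' y : tangent k (a j') (b' j') y = tangent k (a j') (b j') y.
  rewrite /tangent /b'; under eq_bigr => i _ do rewrite mulrDl mulrBl.
  rewrite big_split sumrB /= -addrA -[RHS]addr0; congr (_ + _).
  apply/eqP; rewrite addrC subr_eq0; apply/eqP.
  have aP i : (i < k)%N -> a j' i (y i) * \prod_(0 <= l < k | l != i) a j' l (y l) =
      \prod_(0 <= l < k) a j' l (y l).
    by move=> ik; rewrite [RHS](bigD1_seq i) ?mem_index_iota ?iota_uniq.
  rewrite [LHS](bigD1_seq 0%N) ?mem_index_iota ?iota_uniq //=.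
  rewrite [X in _ + X = _]big1 ?addr0 => [|i /negbTE->]; last by rewrite !mul0r.
  rewrite mul1r -mulrA aP // mulr_suml [LHS]big_mkcond /=.
  apply: eq_big_nat => i /andP[_ ik]; case: eqP => _; last by rewrite mul1r -mulrA aP.
  by rewrite !mul0r.
have b'0 j' i : (0 < i < k)%N -> b' j' i 0%N = 0.
  by case: i => // i _; rewrite /b' /= a0 mul0r mul0r addr0 mul1r mulr1 subrr.
have b'Z d : d \in directions s ns -> b' d.1.1 d.1.2 d.2 = 0.
  pose z : 'rV[K]_(size (directions s ns)) :=
    \row_d (fun d => b' d.1.1 d.1.2 d.2) (nth (0, 0, 0)%N (directions s ns) d).
  have z0 : z = 0.
    apply/eqP; rewrite -(mulmx_free_eq0 _ Mfree); apply/eqP/rowP => u.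
    have /positionsP[_ un] := mem_nth [::] (ltn_ord u).
    rewrite !mxE; pose x' := nth 0%N (nth [::] (positions ns) u).
    transitivity (\sum_(0 <= j < s) tangent k (a j) (b' j) x').
      rewrite -sum_directions // (big_nth (0, 0, 0)%N) big_mkord.
      by apply: eq_bigr => d' _; rewrite !mxE.
    by under eq_bigr => j' _ do rewrite b'E; apply: Hb.
  move=> dd; have := dd; rewrite -index_mem => dlt.
  by have /rowP/(_ (Ordinal dlt)) := z0; rewrite !mxE /= nth_index.
rewrite -b'E /tangent big_nat big1 // => i /andP[_ ik].
suff -> : b' j i (x i) = 0 by rewrite mul0r.
have [x0|x0] := posnP (x i).
  case: (posnP i) => [i0|i0]; last by rewrite x0 b'0 // i0.
  by apply: (b'Z (j, i, x i)); rewrite mem_directions js ik xn // i0.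
by apply: (b'Z (j, i, x i)); rewrite mem_directions js ik xn // x0 orbT.
Qed.

Lemma tangents_span_row_full :
  row_full (tangent_mx s ns a) -> tangents_span s k nn a.
Proof.
move=> /row_fullP[B BM]; split=> // t.
pose v : 'rV[K]_(size (positions ns)) := \row_u t (nth [::] (positions ns) u).
have vE : v = (v *m B) *m tangent_mx s ns a by rewrite -mulmxA BM mulmx1.
pose z d := if insub (index d (directions s ns)) is Some d' then (v *m B) 0 d' else 0.
have zE (d : 'I_(size (directions s ns))) : z (nth (0, 0, 0)%N (directions s ns) d) = (v *m B) 0 d.
  by rewrite /z index_uniq ?directions_uniq // valK.
exists (fun j i c => z (j, i, c)) => x xn.
pose y := mkseq x k.
have yx i : (i < k)%N -> nth 0%N y i = x i by move=> ik; rewrite nth_mkseq.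
have yn : in_box k nn (nth 0%N y) by move=> i ik; rewrite yx // xn.
have : y \in positions ns by apply/positionsP; rewrite size_mkseq.
move=> ymem; have := ymem; rewrite -index_mem => ylt.
transitivity (v 0 (Ordinal ylt)); last by rewrite mxE nth_index.
transitivity (\sum_(0 <= j < s) tangent k (a j) (fun i c => z (j, i, c)) (nth 0%N y)).
  by apply: eq_bigr => j _; apply: eq_tangent => i ik; rewrite yx.
rewrite -(sum_directions (b := fun j i c => z (j, i, c))) => // [|j i /andP[i0 _]]; last first.
  rewrite /z insubF // index_mem mem_directions.
  by rewrite ltnn orbF; case: eqP i0 => [->|]; rewrite ?andbF.
rewrite vE [RHS]mxE (big_nth (0, 0, 0)%N) big_mkord; apply: eq_bigr => d _.
rewrite -zE [tangent_mx _ _ _ _ _]mxE /= nth_index //.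
Qed.

End Base.

(** * Gaussian elimination modulo a prime *)

Section Elimination.
Variable p : nat.

Fixpoint combine (u v : nat) (r s : seq nat) : seq nat :=
  if (r, s) is (x :: r', y :: s') then ((u * y + v * x) %% p)%N :: combine u v r' s' else [::].

(** Checks that the rows are linearly independent modulo p: the first row must
    have an entry prime to p, and is used to clear that column in the other rows
    without division.  Entries are natural numbers, so that the check can be
    evaluated; subtraction is addition of a multiple by p - 1. *)
Fixpoint eliminate (m : nat) (rows : seq (seq nat)) : bool :=
  match m, rows with
  | _, [::] => true
  | m'.+1, r :: rs =>
    let t := find (fun x => x %% p != 0)%N r in
    (nth 0 r t %% p != 0)%N &&
    eliminate m' [seq combine (nth 0 r t)%N (p.-1 * nth 0 s t)%N r s | s <- rs]
  | _, _ => false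
  end.

Hypothesis p_prime : prime p.
Notation F := 'F_p.

Lemma nth_combine u v r s e : size r = size s ->
  nth 0%N (combine u v r s) e = ((u * nth 0 s e + v * nth 0 r e) %% p)%N.
Proof.
elim: r s e => [|x r IH] [|y s] //= e; first by rewrite nth_nil !muln0 mod0n.
by case=> rs; case: e => [|e] //=; apply: IH.
Qed.

Lemma size_combine u v r s : size r = size s -> size (combine u v r s) = size s.
Proof. by elim: r s => [|x r IH] [|y s] //= [/IH->]. Qed.

(** Given a relation with coefficients c, the first row is expressed through
    the others by the pivot column; substituting this gives a relation with the
    coefficients c_1, c_2, ... among the cleared rows. *)
Lemma eliminate_free w m rows (c : nat -> F) :
  eliminate m rows -> all (fun r => size r == w) rows ->
  (forall e, \sum_(i < size rows) c i * (nth 0%N (nth [::] rows i) e)%:R = 0) ->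
  forall i, (i < size rows)%N -> c i = 0.
Proof.
elim: m rows c => [|m IH] [|r rs] //= c /andP[].
set h := nth _ r _; set t := find _ r in h *; move=> h0 elim_rs /andP[/eqP rw rsw] S0.
have hF : h%:R != 0 :> F.
  by rewrite -(dvdn_pcharf (pchar_Fp p_prime)).
have Sum e : c 0%N * (nth 0%N r e)%:R +
    \sum_(i < size rs) c i.+1 * (nth 0%N (nth [::] rs i) e)%:R = 0.
  by have := S0 e; rewrite big_ord_recl.
have c0 i : (i < size rs)%N -> c i.+1 = 0.
  move=> irs; rewrite -[c _]/((c \o S) i); apply: (IH _ _ elim_rs); rewrite ?size_map //.
    apply/allP => _ /mapP[s srs ->]; have /eqP sw := allP rsw s srs.
    by rewrite /= size_combine sw ?rw.
  move=> e; transitivity (h%:R * (\sum_(i < size rs) c i.+1 * (nth 0%N (nth [::] rs i) e)%:R)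
     - (\sum_(i < size rs) c i.+1 * (nth 0%N (nth [::] rs i) t)%:R) * (nth 0%N r e)%:R).
    rewrite mulr_sumr mulr_suml -sumrB; apply: eq_bigr => l _.
    have is_rs := mem_nth [::] (ltn_ord l); have /eqP sw := allP rsw _ is_rs.
    rewrite (nth_map [::]) // nth_combine ?rw ?sw // Fp_nat_mod // natrD !natrM /=.
    have -> : p.-1%:R = -1 :> F.
      by apply/eqP; rewrite -subr_eq0 opprK natr1 prednK ?prime_gt0 // pchar_Fp_0.
    ring.
  have := Sum e; have := Sum t; rewrite -/h; move: (\sum_(_ < _) _) (\sum_(_ < _) _) => X Y.
  move=> /eqP; rewrite addrC addr_eq0 => /eqP->; move=> /eqP; rewrite addrC addr_eq0 => /eqP->.
  ring.
case=> [_|i]; last exact: c0.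
have := Sum t; rewrite big1 ?addr0 => [/eqP|i _]; last by rewrite c0 // mul0r.
by rewrite mulf_eq0 -/h (negbTE hF) orbF => /eqP.
Qed.

Lemma eliminate_row_free m w m' (rows : seq (seq nat)) (A : 'M[F]_(m, w)) :
  eliminate m' rows -> all (fun r => size r == w) rows -> size rows = m ->
  (forall i e, A i e = (nth 0%N (nth [::] rows i) e)%:R) ->
  row_free A.
Proof.
move=> el sw sm AE; rewrite -kermx_eq0; apply/rowV0P => v /sub_kermxP vA.
subst m; pose c i := if insub i is Some i' then v 0 i' else 0.
have cE (i : 'I_(size rows)) : c i = v 0 i by rewrite /c valK.
apply/rowP => i; rewrite -cE mxE; apply: (eliminate_free el sw) => // e.
have [ew|we] := ltnP e w.
  have := congr1 (fun u : 'rV_w => u 0 (Ordinal ew)) vA; rewrite !mxE => E; rewrite -[RHS]E.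
  by apply: eq_bigr => l _; rewrite cE AE.
apply: big1 => l _; rewrite nth_default ?mulr0 //.
by have /eqP-> := allP sw _ (mem_nth [::] (ltn_ord l)).
Qed.

(** Lift a right inverse modulo p to an integer matrix: the product has
    determinant 1 modulo p, hence a nonzero integer determinant. *)
Lemma row_free_char0 (K : fieldType) m w (A : 'M[int]_(m, w)) :
  [pchar K] =i pred0 ->
  row_free (map_mx intr A : 'M[F]_(m, w)) -> row_free (map_mx intr A : 'M[K]_(m, w)).
Proof.
move=> charK /row_freeP[B AB].
pose B' : 'M[int]_(w, m) := map_mx (fun x : F => (x : nat)%:Z) B.
have detF : (\det (A *m B'))%:~R = 1 :> F.
  rewrite -det_map_mx map_mxM -(det1 F m) -AB; congr (\det (_ *m _)).
  by apply/matrixP => i j; rewrite !mxE /= -pmulrn natr_Zp.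
have detK : (\det (A *m B'))%:~R != 0 :> K.
  have : \det (A *m B') != 0.
    by apply: contra_eq_neq detF => ->; rewrite eq_sym oner_eq0.
  have natK d : (d%:R == 0 :> K) = (d == 0%N) by rewrite ((pcharf0P _).1 charK).
  case: (\det _) => d d0; first by change (d%:R != 0 :> K); rewrite natK.
  by rewrite NegzE rmorphN oppr_eq0; change (d.+1%:R != 0 :> K); rewrite natK.
have : (map_mx intr A *m map_mx intr B' : 'M[K]_m) \in unitmx.
  by rewrite -map_mxM unitmxE det_map_mx unitfE.
rewrite -row_free_unit => /row_freeP[C ABC]; apply/row_freeP.
by exists (map_mx intr B' *m C); rewrite mulmxA.
Qed.

End Elimination.


Section Certificate.
Variables (p s : nat) (ns : seq nat) (a : nat -> nat -> nat -> nat).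

Definition entry_mod (d : nat * nat * nat) (x : seq nat) : nat :=
  let: (j, i, c) := d in
  if nth 0%N x i == c
  then foldr (fun l r => if l == i then r else (a j l (nth 0 x l) * r) %% p)%N
         1%N (iota 0 (size ns))
  else 0%N.

Definition tangent_rows :=
  [seq [seq entry_mod d x | x <- positions ns] | d <- directions s ns].
Definition tangent_cols :=
  [seq [seq entry_mod d x | d <- directions s ns] | x <- positions ns].

Definition eliminate_all (rows : seq (seq nat)) := eliminate p (size rows) rows.

Lemma map_tangent_mx (R : comNzRingType) :
  map_mx intr (tangent_mx s ns (fun j i c => (a j i c)%:R : int)) =
  tangent_mx s ns (fun j i c => (a j i c)%:R : R).
Proof.
apply/matrixP => d x; rewrite !mxE /entry; case: (nth _ _ d) => [[j i] c].
rewrite rmorphM rmorph_prod !rmorph_nat; congr (_ * _).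
by apply: eq_bigr => l _; rewrite rmorph_nat.
Qed.

Hypothesis p_prime : prime p.

Lemma entry_modE d x :
  (entry_mod d x)%:R = entry ns (fun j i c => (a j i c)%:R : 'F_p) d (nth 0%N x).
Proof.
case: d => [[j i] c]; rewrite /entry_mod /entry; case: eqP => _; last by rewrite mul0r.
rewrite mul1r /index_iota subn0; elim: (iota _ _) => [|l ls IH]; first by rewrite big_nil.
by rewrite big_cons -IH /=; case: eqP => //= _; rewrite Fp_nat_mod // natrM.
Qed.

Variables (K : fieldType).
Hypothesis charK : [pchar K] =i pred0.
Hypotheses (ns_gt0 : (0 < size ns)%N) (a0 : forall j i, a j i 0%N = 1%N).
Let aK j i c : K := (a j i c)%:R.

Let aK0 j i : aK j i 0%N = 1. Proof. by rewrite /aK a0. Qed.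

Lemma independent_certificate :
  eliminate_all tangent_rows -> tangents_independent s (size ns) (nth 0%N ns) aK.
Proof.
move=> el; apply: (tangents_independent_row_free (a := aK)) => //.
rewrite -map_tangent_mx; apply: (@row_free_char0 p K); rewrite ?map_tangent_mx //.
apply: (eliminate_row_free p_prime el) => [||d x].
- by apply/allP => _ /mapP[d _ ->]; rewrite size_map.
- by rewrite size_map.
by rewrite (nth_map (0, 0, 0)%N) // (nth_map [::]) // entry_modE mxE.
Qed.

Lemma span_certificate :
  eliminate_all tangent_cols -> tangents_span s (size ns) (nth 0%N ns) aK.
Proof.
move=> el; apply: (tangents_span_row_full (a := aK)) => //.
rewrite /row_full -mxrank_tr -/(row_free _) -map_tangent_mx map_trmx.
apply: (@row_free_char0 p K); rewrite -?map_trmx ?map_tangent_mx //.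
apply: (eliminate_row_free p_prime el) => [||x d].
- by apply/allP => _ /mapP[d _ ->]; rewrite size_map.
- by rewrite size_map.
by rewrite (nth_map [::]) // (nth_map (0, 0, 0)%N) // entry_modE !mxE.
Qed.

End Certificate.


(** * The small formats and the classification *)

(** Any general points would do for the formats below.  The list holds the
    residues modulo 7 of the cubes modulo 23, as a supply of entries without
    visible structure. *)
Definition generic_points (j i c : nat) : nat :=
  if c == 0%N then 1%N else
  nth 0%N [:: 0; 1; 1; 4; 4; 3; 2; 0; 6; 2; 4; 6; 3; 5; 0; 3; 2; 0; 6; 5; 5; 1; 1]%N
    ((j + 8 * i + c + 1) %% 23).

(** A general tensor of format (1, 5, 5) is a pencil of matrices that is
    simultaneously diagonalizable with six distinct eigenvalues, so its six
    summands need pairwise distinct first factors, which few choices modulo 7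
    allow: these factors lie on rational normal curves, at the parameters 0
    to 5. *)
Definition pencil_points (j i c : nat) : nat := (j ^ c %% 7)%N.

Section BaseCases.
Variable K : fieldType.
Hypothesis charK : [pchar K] =i pred0.
Let points j i c : K := (generic_points j i c)%:R.
Let pencil j i c : K := (pencil_points j i c)%:R.
Notation independent ns := (tangents_independent 6 (size ns%N) (nth 0%N ns%N)).
Notation spanning ns := (tangents_span 6 (size ns%N) (nth 0%N ns%N)).

Lemma independent_mod7 ns a : (0 < size ns)%N -> (forall j i, a j i 0%N = 1%N) ->
  eliminate_all 7 (tangent_rows 7 6 ns a) -> independent ns (fun j i c => (a j i c)%:R : K).
Proof. by move=> *; apply: (@independent_certificate 7). Qed.

Lemma span_mod7 ns a : (0 < size ns)%N -> (forall j i, a j i 0%N = 1%N) ->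
  eliminate_all 7 (tangent_cols 7 6 ns a) -> spanning ns (fun j i c => (a j i c)%:R : K).
Proof. by move=> *; apply: (@span_certificate 7). Qed.

Lemma independent_155 : independent [:: 1; 5; 5] pencil.
Proof. apply: independent_mod7; [by []|by []|by vm_compute]. Qed.

Lemma span_155 : spanning [:: 1; 5; 5] pencil.
Proof. apply: span_mod7; [by []|by []|by vm_compute]. Qed.

Lemma independent_234 : independent [:: 2; 3; 4] points.
Proof. apply: independent_mod7; [by []|by []|by vm_compute]. Qed.

Lemma span_234 : spanning [:: 2; 3; 4] points.
Proof. apply: span_mod7; [by []|by []|by vm_compute]. Qed.

Lemma independent_333 : independent [:: 3; 3; 3] points.
Proof. apply: independent_mod7; [by []|by []|by vm_compute]. Qed.

Lemma span_225 : spanning [:: 2; 2; 5] points.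
Proof. apply: span_mod7; [by []|by []|by vm_compute]. Qed.

Lemma independent_1123 : independent [:: 1; 1; 2; 3] points.
Proof. apply: independent_mod7; [by []|by []|by vm_compute]. Qed.

Lemma span_1123 : spanning [:: 1; 1; 2; 3] points.
Proof. apply: span_mod7; [by []|by []|by vm_compute]. Qed.

Lemma independent_1222 : independent [:: 1; 2; 2; 2] points.
Proof. apply: independent_mod7; [by []|by []|by vm_compute]. Qed.

Lemma span_1115 : spanning [:: 1; 1; 1; 5] points.
Proof. apply: span_mod7; [by []|by []|by vm_compute]. Qed.

Lemma independent_11112 : independent [:: 1; 1; 1; 1; 2] points.
Proof. apply: independent_mod7; [by []|by []|by vm_compute]. Qed.

Lemma span_11111 : spanning [:: 1; 1; 1; 1; 1] points.
Proof. apply: span_mod7; [by []|by []|by vm_compute]. Qed.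

Lemma independent_111111 : independent [:: 1; 1; 1; 1; 1; 1] points.
Proof. apply: independent_mod7; [by []|by []|by vm_compute]. Qed.

Lemma independent_ones m : tangents_independent 6 (6 + m) (nth 0%N [:: 1; 1; 1; 1; 1; 1]%N) points.
Proof.
elim: m => [|m IH]; first exact: independent_111111.
by rewrite addnS; apply: tangents_independent_pad IH => //; rewrite nth_default.
Qed.

(** The first two factors of the points run through the products of the bases
    e_0, e_0 + e_1 and e_0, e_0 + e_1, e_0 + e_2; expanding the target in the
    product basis gives the directions in the third factor. *)
Lemma span_12c c : exists a, spanning [:: 1; 2; c] (a : nat -> nat -> nat -> K).
Proof.
pose q j := nth 0%N [:: 0; 1; 2; 0; 1; 2]%N j.
exists (fun j i e => if e == 0%N then 1 else
  if i == 0%N then (3 <= j)%N%:R else if i == 1%N then (q j == e)%N%:R else 0).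
split=> // t.
pose X j q e : K := if (3 <= j)%N then t [:: 1; q; e]%N else t [:: 0; q; e]%N - t [:: 1; q; e]%N.
pose Y j e : K := if q j == 0%N then X j 0%N e - X j 1%N e - X j 2%N e else X j (q j) e.
exists (fun j i e => if i == 2%N then Y j e else 0) => x xn.
have -> : mkseq x (size [:: 1; 2; c]%N) = [:: x 0%N; x 1%N; x 2%N] by [].
have := xn 0%N isT; have := xn 1%N isT; rewrite /= /tangent /index_iota /= unlock /=.
by move: (x 1%N) (x 0%N) => [|[|[|?]]] [|[|?]] // _ _; rewrite /Y /X /=; ring.
Qed.


End BaseCases.

Local Close Scope ring_scope.

Theorem theorem4p13 (K : fieldType) (charK : [pchar K]%R =i pred0)
    (k : nat) (n : k.-tuple nat)
    (k_ge3 : 3 <= k)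
    (n_ge1 : forall i : 'I_k, 1 <= tnth n i)
    (n_nondecr : forall i j : 'I_k, i <= j -> tnth n i <= tnth n j) :
  let exception :=
    exists2 a : nat, 6 <= a &
      [\/ k = 3 /\ tval n = [:: 1; 3; a],
          k = 3 /\ tval n = [:: 1; 4; a],
          k = 3 /\ tval n = [:: 2; 2; a] |
          k = 4 /\ tval n = [:: 1; 1; 1; a]] in
  (~ exception -> segre_secant_nondefective K n 6) /\
  (exception -> segre_secant_defective K n 6).
Proof.
have k_gt0 : 0 < k by apply: leq_trans k_ge3.
set nn := nth 0 n.
have nE : tval n = mkseq nn k by rewrite -[k in RHS](size_tuple n) mkseq_nth.
have nn_ge1 i : i < k -> 1 <= nn i.
  by move=> ik; have := n_ge1 (Ordinal ik); rewrite (tnth_nth 0).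
have nn_le i j : i <= j -> j < k -> nn i <= nn j.
  move=> ij jk; have := @n_nondecr (Ordinal (leq_ltn_trans ij jk)) (Ordinal jk) ij.
  by rewrite !(tnth_nth 0).
have indep n0 a : tangents_independent 6 k n0 (a : nat -> nat -> nat -> K) ->
    in_box k nn n0 -> segre_secant_nondefective K n 6.
  move=> ind n0n; have := tangents_independent_raise n0n ind => ind'.
  exact: (@nondefective_of_tangents_independent K k n 6 charK k_gt0 isT _ (proj1 ind') ind').
have span n0 a : tangents_span 6 k n0 (a : nat -> nat -> nat -> K) ->
    in_box k n0 nn -> segre_secant_nondefective K n 6.
  move=> spn nn0; have spn' := tangents_span_sub nn0 spn.
  exact: (@nondefective_of_tangents_span K k n 6 charK k_gt0 isT _ (proj1 spn') spn').
move=> exception; split=> [no_exc|]; last first.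
- case=> a a6 exc; have tE i : tnth n i = nth 0 (tval n) i := tnth_nth 0 n i.
  case: exc => -[k_eq n_eq]; subst k;
    apply: (@defective_of_unbalanced K _ n 6 charK k_gt0 isT ord_max);
    rewrite ?[X in _ < X]big_mkcond ?big_mkcond ?big_ord_recl ?big_ord0 ?tE n_eq //=;
    by rewrite big_mkcond !big_ord_recl big_ord0 !tE n_eq.
move: (segre_secant_nondefective K n 6) indep span => goal indep span.
have in_box3 m m' : m 0 <= m' 0 -> m 1 <= m' 1 -> m 2 <= m' 2 -> in_box 3 m' m.
  by move=> ? ? ? [|[|[|]]].
have in_box4 m m' : m 0 <= m' 0 -> m 1 <= m' 1 -> m 2 <= m' 2 -> m 3 <= m' 3 -> in_box 4 m' m.
  by move=> ? ? ? ? [|[|[|[|]]]].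
have in_box5 m m' : m 0 <= m' 0 -> m 1 <= m' 1 -> m 2 <= m' 2 -> m 3 <= m' 3 ->
    m 4 <= m' 4 -> in_box 5 m' m.
  by move=> ? ? ? ? ? [|[|[|[|[|]]]]].
have [k3|[k4|[k5|[m km]]]] : k = 3 \/ k = 4 \/ k = 5 \/ exists m, k = 6 + m.
- by move: k_ge3; case: (k) => [|[|[|[|[|[|m]]]]]] //; auto; do 3!right; exists m.
- have n0 : 1 <= nn 0 by apply: nn_ge1; rewrite k3.
  have n01 : nn 0 <= nn 1 by apply: nn_le; rewrite ?k3.
  have n12 : nn 1 <= nn 2 by apply: nn_le; rewrite ?k3.
  have nv : tval n = [:: nn 0; nn 1; nn 2] by rewrite nE k3.
  (* The only use of the exclusion of the exceptional formats with three factors. *)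
  have z5 : (nn 0 = 1 /\ nn 1 = 3) \/ (nn 0 = 1 /\ nn 1 = 4) \/ (nn 0 = 2 /\ nn 1 = 2) -> nn 2 <= 5.
    move=> n01E; rewrite leqNgt; apply/negP => n2; apply: no_exc; exists (nn 2) => //.
    by rewrite nv; case: n01E => [[-> ->]|[[-> ->]|[-> ->]]];
      [apply: Or41|apply: Or42|apply: Or43].
  rewrite k3 in indep span.
  have [/andP[x1 y2]|xy] := boolP ((nn 0 <= 1) && (nn 1 <= 2)).
    have [a spa] := span_12c K (nn 2).
    by apply: span spa _; apply: in_box3.
  have [y5|y4] := leqP 5 (nn 1).
    by apply: indep (independent_155 charK) _; apply: in_box3 => //=; lia.
  have [x1|x2] := leqP (nn 0) 1.
    by apply: span (span_155 charK) _; apply: in_box3 => //=; lia.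
  have [y2|y3] := leqP (nn 1) 2.
    by apply: span (span_225 charK) _; apply: in_box3 => //=; lia.
  have [z4|z3] := leqP 4 (nn 2).
    by apply: indep (independent_234 charK) _; apply: in_box3 => //=; lia.
  have [x3|x2'] := leqP 3 (nn 0).
    by apply: indep (independent_333 charK) _; apply: in_box3 => //=; lia.
  by apply: span (span_234 charK) _; apply: in_box3 => //=; lia.
- have n0 : 1 <= nn 0 by apply: nn_ge1; rewrite k4.
  have n01 : nn 0 <= nn 1 by apply: nn_le; rewrite ?k4.
  have n12 : nn 1 <= nn 2 by apply: nn_le; rewrite ?k4.
  have n23 : nn 2 <= nn 3 by apply: nn_le; rewrite ?k4.
  have nv : tval n = [:: nn 0; nn 1; nn 2; nn 3] by rewrite nE k4.
  (* The only use of the exclusion of the exceptional formats with four factors. *)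
  have w5 : nn 0 = 1 -> nn 1 = 1 -> nn 2 = 1 -> nn 3 <= 5.
    move=> x1 y1 z1; rewrite leqNgt; apply/negP => n3; apply: no_exc; exists (nn 3) => //.
    by rewrite nv x1 y1 z1; apply: Or44.
  rewrite k4 in indep span.
  have [z1|z2] := leqP (nn 2) 1.
    by apply: span (span_1115 charK) _; apply: in_box4 => //=; lia.
  have [w3|w2] := leqP 3 (nn 3).
    by apply: indep (independent_1123 charK) _; apply: in_box4 => //=; lia.
  have [y1|y2] := leqP (nn 1) 1.
    by apply: span (span_1123 charK) _; apply: in_box4 => //=; lia.
  by apply: indep (independent_1222 charK) _; apply: in_box4 => //=; lia.
- have n_pos i : i < 5 -> 1 <= nn i by rewrite -k5; apply: nn_ge1.
  have n_le4 i : i <= 4 -> nn i <= nn 4 by move=> i4; apply: nn_le; rewrite ?k5.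
  rewrite k5 in indep span.
  have [v1|v2] := leqP (nn 4) 1.
    by apply: span (span_11111 charK) _; apply: in_box5; apply: leq_trans v1; apply: n_le4.
  by apply: indep (independent_11112 charK) _; apply: in_box5 => //=; apply: n_pos.
rewrite km in indep; apply: indep (independent_ones charK m) _ => i ik.
case: i ik => [|[|[|[|[|[|i]]]]]] //=; rewrite ?nth_nil // => ik; apply: nn_ge1; rewrite km; lia.
Qed.
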